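(* Let $n$ be an integer with $5\nmid n$, and let $\beta_0,\beta_1,\beta_2,\beta_3,m\in\mathbb Z$ be as defined in the context. For $k\in\mathbb Z$ put $\theta_0(k)=a_k\beta_0+b_k\beta_1-c_k\beta_2-c_k\beta_3$, $\theta_1(k)=b_k\beta_0+a_k\beta_1+b_k\beta_2-c_k\beta_3$, $\theta_2(k)=-c_k\beta_0+b_k\beta_1+a_k\beta_2+b_k\beta_3$, $\theta_3(k)=-c_k\beta_0-c_k\beta_1+b_k\beta_2+a_k\beta_3$, $\theta_4(k)=b_k\beta_0-c_k\beta_1-c_k\beta_2+b_k\beta_3$, and $$\xi_k=\frac{1}{bc^2d^3e^4}\left(\sum_{t=0}^4\theta_t(k)\rho^{(t)}-(-1)^km\right).$$ Then the set of all generators of normal integral bases of $K_n$ equals $\{\pm\sigma^\ell(\xi_k)\ :\ \ell\in\mathbb Z/5\mathbb Z,\ k\in\mathbb Z\}$.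
   Context: For an integer $n$, let $f_n(X)=X^5+n^2X^4-(2n^3+6n^2+10n+10)X^3+(n^4+5n^3+11n^2+15n+5)X^2+(n^3+4n^2+10n+10)X+1$ (irreducible over $\mathbb Q$). Let $\rho$ be a root of $f_n$, $K_n=\mathbb Q(\rho)$ (cyclic quintic) with ring of integers $\mathcal O_{K_n}$, $\sigma$ the generator of $\mathrm{Gal}(K_n/\mathbb Q)$ with $\sigma(\rho)=\frac{n+2+n\rho-\rho^2}{1+(n+2)\rho}$, and $\rho^{(i)}=\sigma^i(\rho)$. Let $\Delta_n=n^4+5n^3+15n^2+25n+25=ab^2c^3d^4e^5$ with $a,b,c,d,e$ positive integers, $a,b,c,d$ square-free and pairwise coprime. $\left(\frac n5\right)$ is the Legendre symbol. Let $\zeta$ be a primitive fifth root of unity, $A_n=n+2+2\zeta^4+\zeta^2$, $B_n=n+2+2\zeta^2+\zeta$, $C_n=n+2+2\zeta^3+\zeta^4$. For $\lambda\in\mathbb Z[\zeta]\setminus(1-\zeta)$ with residue $1,-1,2,-2$ modulo $(1-\zeta)$, let $u_\lambda=1,-1,\frac{1+\sqrt5}2,-\frac{1+\sqrt5}2$ respectively. Define $\alpha_1$: write $bc^2d^3e^3=p_1\cdots p_k$ (primes, not necessarily distinct), choose prime elements $\pi_i$ of $\mathbb Z[\zeta]$ with $\pi_i\mid p_i$ and $\pi_i\mid A_n$ (these exist), $\lambda_1=\prod\pi_i$, $\alpha_1=u_{\lambda_1}\lambda_1$. Define $\alpha_2$ in the same way from $bcd^2e^2$ and $B_n$, and $\alpha_3$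 in the same way from $cde$ and $C_n$. Write $\alpha_1\alpha_2\alpha_3=\beta_0+\beta_1\zeta+\beta_2\zeta^2+\beta_3\zeta^3$ with $\beta_j\in\mathbb Z$, and $m=\frac15\left(\left(\frac n5\right)bc^2d^3e^4-n^2(\beta_0+\beta_1+\beta_2+\beta_3)\right)\in\mathbb Z$. Let $\lambda=\frac{3+\sqrt5}2$, $\bar\lambda=\frac{3-\sqrt5}2$, and for $k\in\mathbb Z$: $a_k=\frac15\left((-1)^k+2(\lambda^k+\bar\lambda^k)\right)$, $b_k=\frac12(a_k-a_{k-1})$, $c_k=\frac12(a_{k+1}-a_k)$. A generator of a normal integral basis is an $\alpha\in K_n$ such that $\{\sigma^i(\alpha)\}_{i=0}^4$ is a $\mathbb Z$-basis of $\mathcal O_{K_n}$. *)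

(* Defs.v *)
From HB Require Import structures.
From mathcomp Require Import all_boot all_order all_fingroup all_algebra.
From mathcomp Require Import all_solvable all_field.
From mathcomp Require Import ring.

Set Implicit Arguments.
Unset Strict Implicit.
Unset Printing Implicit Defensive.

Import Order.TTheory GRing.Theory Num.Theory.
Local Open Scope ring_scope.

Definition lehmer_poly (n : int) : {poly int} :=
  'X^5 + n ^+ 2 *: 'X^4
  - (2 * n ^+ 3 + 6 * n ^+ 2 + 10 * n + 10) *: 'X^3
  + (n ^+ 4 + 5 * n ^+ 3 + 11 * n ^+ 2 + 15 * n + 5) *: 'X^2
  + (n ^+ 3 + 4 * n ^+ 2 + 10 * n + 10) *: 'X + 1.

Definition Delta (n : int) : int :=
  n ^+ 4 + 5 * n ^+ 3 + 15 * n ^+ 2 + 25 * n + 25.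

Definition squarefree (m : nat) : Prop :=
  forall q : nat, (q ^ 2 %| m)%N -> q = 1%N.

Definition legendre (x : int) (p : nat) : int :=
  if (p %| x)%Z then 0
  else if [exists y : 'I_p, ((y : nat)%:Z ^+ 2 == x %[mod p])%Z] then 1
  else -1.

(* The ring Z[z] as a subset of algC, with divisibility and prime elements     *)
(* taken relative to that subring.                                             *)
Definition Zadj (z x : algC) : Prop :=
  exists p : {poly int}, x = (map_poly intr p).[z].

Definition Zadj_dvd (z x y : algC) : Prop :=
  exists2 q : algC, Zadj z q & y = q * x.

Definition Zadj_prime (z x : algC) : Prop :=
  [/\ Zadj z x, x != 0, ~ Zadj_dvd z x 1 &
      forall y w, Zadj z y -> Zadj z w -> Zadj_dvd z x (y * w) ->
        Zadj_dvd z x y \/ Zadj_dvd z x w].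

Definition golden : algC := (1 + sqrtC 5) / 2.

(* u is the unit u_lam attached to the residue of lam modulo (1 - z).          *)
Definition residue_unit (z lam u : algC) : Prop :=
  [\/ Zadj_dvd z (1 - z) (lam - 1) /\ u = 1,
      Zadj_dvd z (1 - z) (lam + 1) /\ u = -1,
      Zadj_dvd z (1 - z) (lam - 2) /\ u = golden |
      Zadj_dvd z (1 - z) (lam + 2) /\ u = - golden].

(* alpha is one of the admissible values u_lam * lam built from N and A: the   *)
(* pairs in s are the (p_i, pi_i), with N the product of the p_i and lam the   *)
(* product of the pi_i.                                                        *)
Definition normalized_factor (z : algC) (N : nat) (A alpha : algC) : Prop :=
  exists s : seq (nat * algC), exists u : algC,
  [/\ N = (\prod_(x <- s) x.1)%N,
      forall x, x \in s ->
        [/\ prime x.1, Zadj_prime z x.2,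
            Zadj_dvd z x.2 x.1%:R & Zadj_dvd z x.2 A],
      residue_unit z (\prod_(x <- s) x.2) u &
      alpha = u * \prod_(x <- s) x.2].

Definition A_ (z : algC) (n : int) : algC := n%:~R + 2 + 2 * z ^+ 4 + z ^+ 2.
Definition B_ (z : algC) (n : int) : algC := n%:~R + 2 + 2 * z ^+ 2 + z.
Definition C_ (z : algC) (n : int) : algC := n%:~R + 2 + 2 * z ^+ 3 + z ^+ 4.

Definition lambda : algC := (3 + sqrtC 5) / 2.
Definition lambda_bar : algC := (3 - sqrtC 5) / 2.

Definition a_alg (k : int) : algC :=
  5^-1 * ((-1) ^ k + 2 * (lambda ^ k + lambda_bar ^ k)).

(* The a_k are rational (a_seqE), so they may be used as scalars of K_n.       *)
Definition a_seq (k : int) : rat := getCrat (a_alg k).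
Definition b_seq (k : int) : rat := (a_seq k - a_seq (k - 1)) / 2.
Definition c_seq (k : int) : rat := (a_seq (k + 1) - a_seq k) / 2.

Lemma lambda_mul : lambda * lambda_bar = 1.
Proof.
have h5 : sqrtC 5 ^+ 2 = 5 :> algC by rewrite sqrtCK.
by rewrite /lambda /lambda_bar; field: h5.
Qed.

Lemma lambda_rat (k : int) : lambda ^ k + lambda_bar ^ k \in Crat.
Proof.
have h5 : sqrtC 5 ^+ 2 = 5 :> algC by rewrite sqrtCK.
have hs : lambda + lambda_bar = 3 by rewrite /lambda /lambda_bar; field.
have hm := lambda_mul.
have hn (j : nat) : lambda ^+ j + lambda_bar ^+ j \in Crat.
  suff: (lambda ^+ j + lambda_bar ^+ j \in Crat)
        && (lambda ^+ j.+1 + lambda_bar ^+ j.+1 \in Crat) by case/andP.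
  elim: j => [|j /andP[h0 h1]].
    by rewrite !expr0 !expr1 hs rpredD ?rpred1 ?rpred_nat.
  rewrite h1 /=.
  have -> : lambda ^+ j.+2 + lambda_bar ^+ j.+2 =
    (lambda + lambda_bar) * (lambda ^+ j.+1 + lambda_bar ^+ j.+1)
    - (lambda * lambda_bar) * (lambda ^+ j + lambda_bar ^+ j).
    by rewrite !exprS; ring.
  by rewrite hs hm mul1r rpredB ?rpredM ?rpred_nat.
case: k => j; first exact: hn.
have lV : lambda^-1 = lambda_bar.
  by apply: (mulfI (x := lambda)); rewrite ?hm ?divff //;
     apply/eqP => l0; move/eqP: hm; rewrite l0 mul0r eq_sym oner_eq0.
by rewrite !NegzE -!exprz_inv -lV invrK lV addrC; apply: hn.
Qed.

Lemma a_seqE (k : int) : ratr (a_seq k) = a_alg k :> algC.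
Proof.
apply: getCratK; rewrite /a_alg rpredM ?rpredV ?rpred_nat //.
rewrite rpredD ?rpredM ?rpred_nat ?lambda_rat //.
by case: k => j; rewrite ?NegzE -?exprz_inv ?invrN1 rpredX // rpredN rpred1.
Qed.

Definition theta (beta0 beta1 beta2 beta3 k : int) (t : 'I_5) : rat :=
  let a := a_seq k in let b := b_seq k in let c := c_seq k in
  let x0 : rat := beta0%:~R in let x1 : rat := beta1%:~R in
  let x2 : rat := beta2%:~R in let x3 : rat := beta3%:~R in
  [:: a * x0 + b * x1 - c * x2 - c * x3;
      b * x0 + a * x1 + b * x2 - c * x3;
      - c * x0 + b * x1 + a * x2 + b * x3;
      - c * x0 - c * x1 + b * x2 + a * x3;
      b * x0 - c * x1 - c * x2 + b * x3]`_t.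

Definition m_const (n : int) (b c d e : nat) (beta0 beta1 beta2 beta3 : int) :
    rat :=
  5^-1 * (legendre n 5 * (b * c ^ 2 * d ^ 3 * e ^ 4)%N%:Z
          - n ^+ 2 * (beta0 + beta1 + beta2 + beta3))%:~R.

Section NumberField.
Variable L : splittingFieldType rat.
Implicit Types (sigma : gal_of {:L}) (x rho : L).

Definition xi sigma rho (n : int) (b c d e : nat)
    (beta0 beta1 beta2 beta3 k : int) : L :=
  ((b * c ^ 2 * d ^ 3 * e ^ 4)%N%:R : rat)^-1 *:
  (\sum_(t < 5) theta beta0 beta1 beta2 beta3 k t *: (sigma ^+ t)%g rho
   - ((-1) ^ k * m_const n b c d e beta0 beta1 beta2 beta3)%:A).

Definition is_Zbasis (O : L -> Prop) (r : nat) (v : 'I_r -> L) : Prop :=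
  [/\ forall i, O (v i),
      forall x, O x -> exists w : 'I_r -> int, x = \sum_i v i *~ w i &
      forall w : 'I_r -> int, \sum_i v i *~ w i = 0 -> forall i, w i = 0].

Definition ring_of_integers (x : L) : Prop :=
  integralOver (intr : int -> L) x.

Definition normal_integral_generator sigma x : Prop :=
  is_Zbasis ring_of_integers (fun i : 'I_5 => (sigma ^+ i)%g x).

End NumberField.

(* Main.v *)
(* Let [tau(z) = sum_t z^-t rho^(t)] be the Lagrange resolvent of [rho].  Then
   [tau(z)^2 = - C_n D_n tau(z^2)], where [C_n], [B_n] and [D_n] are the
   conjugates of [A_n] under [z -> z^2, z^3, z^4], and [tau(z) tau(z^-1) = Delta_n];
   hence [tau^5 = - A_n B_n^2 C_n^3 D_n^4].  The prime elements entering
   [alpha = alpha1 alpha2 alpha3] are the ones needed to turn [alpha tau / M],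
   [M = b c^2 d^3 e^4], into an integer [gamma] with [gamma gamma' = unit * f]
   and [f | gamma^5], where [f = a b c d] is squarefree and [gamma'] is the
   resolvent for [z^-1].  As [gamma] is the resolvent of [xi_0], whose trace is
   [+-1], this makes [xi_0] integral.  If [x = X xi_0], [X] in [Q[C5]], is
   integral, then [f | (f X(z))^5]; [Z[z]/f] being reduced, [X(z)] lies in
   [Z[z]], and the trace forces [X] into [Z[C5]].  So [xi_0] generates a normal
   integral basis, and the other generators are its multiples by units of
   [Z[C5]].  For such a unit [Y] the element [Y / Y*] is [+- g^i], so [Y] is
   symmetric up to a power of [g], and symmetric units are found by descent on
   [p^2 - p q - q^2 = 1]. *)

(* The denominators 5 and [M] are removed together. The units [u_lambda] make [alpha] congruent to 1
   modulo [1 - z]; norms from [Z[z]] that are prime to 5 are 1 modulo 5, hence so is [M]; and the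
   Legendre symbol is [n^2] modulo 5. These three congruences make [m] an integer. Then [5 xi_0] is
   integral through its resolvents, [M xi_0] is integral by its shape, and [M = 1] modulo 5 combines
   the two. The assumption on [n] makes [Delta_n] prime to 5. The conjugates of [A_n] differ by
   divisors of 5, so away from 5 they are comaximal: a prime above [p] that divides [A_n] has norm
   [p] and divides no other conjugate. Divisibility by such primes can therefore be read off from
   norms. The unit behind [a_k], [b_k], [c_k] is [1 - (g^2 + g^3)]. The characters of [C5] send it
   to -1, [lambda] and [lambda_bar], and the formula for [a_k] is Fourier inversion. Units of norm
   -1, such as the golden ratio, do not occur among the symmetric units, because there the norm is
   the square of the augmentation modulo 5. *)
From HB Require Import structures.
Require Import Defs.
From mathcomp Require Import all_boot all_order all_fingroup all_algebra.
From mathcomp Require Import all_solvable all_field.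
From mathcomp Require Import ring lra zify.

Set Implicit Arguments.
Unset Strict Implicit.
Unset Printing Implicit Defensive.

Import Order.TTheory GRing.Theory Num.Theory.
Local Open Scope ring_scope.

(** * Conjugates of a root of Lehmer's quintic *)

Section LehmerConjugates.

Variable F : fieldType.
Implicit Types n x : F.

(** Its square is the norm of [1 + (n + 2) rho], the denominator of [sigma]. It is a common
    denominator for the coordinates of the conjugates of [rho] in powers of [rho]; the numerators
    follow. *)
Definition lehmer_den n : F := n ^+ 3 + 5 * n ^+ 2 + 10 * n + 7.

Definition lehmer_num1 n x : F :=
  (n ^+ 4 + 8 * n ^+ 3 + 26 * n ^+ 2 + 39 * n + 22)
  + (n ^+ 6 + 9 * n ^+ 5 + 37 * n ^+ 4 + 89 * n ^+ 3 + 131 * n ^+ 2 + 107 * n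
     + 36) * x
  + (- 2 * n ^+ 5 - 14 * n ^+ 4 - 43 * n ^+ 3 - 76 * n ^+ 2 - 80 * n - 39)
    * x ^+ 2
  + (n ^+ 4 + 4 * n ^+ 3 + 4 * n ^+ 2 - n - 2) * x ^+ 3
  + (n ^+ 2 + 4 * n + 4) * x ^+ 4.

Definition lehmer_num2 n x : F :=
  (- 2 * n ^+ 2 - 7 * n - 6)
  + (- n ^+ 5 - 7 * n ^+ 4 - 21 * n ^+ 3 - 36 * n ^+ 2 - 29 * n - 6) * x
  + (3 * n ^+ 4 + 14 * n ^+ 3 + 31 * n ^+ 2 + 41 * n + 24) * x ^+ 2
  + (- 2 * n ^+ 3 - 4 * n ^+ 2 - 3 * n - 2) * x ^+ 3
  + (- 2 * n - 3) * x ^+ 4.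

Definition lehmer_num3 n x : F :=
  (- n ^+ 5 - 7 * n ^+ 4 - 24 * n ^+ 3 - 47 * n ^+ 2 - 52 * n - 25)
  + (- n ^+ 6 - 8 * n ^+ 5 - 29 * n ^+ 4 - 62 * n ^+ 3 - 81 * n ^+ 2 - 59 * n
     - 18) * x
  + (2 * n ^+ 5 + 12 * n ^+ 4 + 33 * n ^+ 3 + 54 * n ^+ 2 + 53 * n + 23)
    * x ^+ 2
  + (- n ^+ 4 - 3 * n ^+ 3 - 2 * n ^+ 2 + n + 1) * x ^+ 3
  + (- n ^+ 2 - 3 * n - 2) * x ^+ 4.

Definition lehmer_num4 n x : F :=
  (n ^+ 4 + 6 * n ^+ 3 + 16 * n ^+ 2 + 20 * n + 9)
  + (- n ^+ 4 - 7 * n ^+ 3 - 19 * n ^+ 2 - 29 * n - 19) * x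
  + (- n ^+ 4 - 4 * n ^+ 3 - 9 * n ^+ 2 - 14 * n - 8) * x ^+ 2
  + (n ^+ 3 + 2 * n ^+ 2 + 3 * n + 3) * x ^+ 3
  + (n + 1) * x ^+ 4.

Variables n x : F.
Let D := lehmer_den n.
Let r1 := lehmer_num1 n x / D.
Let r2 := lehmer_num2 n x / D.
Let r3 := lehmer_num3 n x / D.
Let r4 := lehmer_num4 n x / D.

Hypothesis D_neq0 : D != 0.
Hypothesis hx : x ^+ 5 = - (n ^+ 2 * x ^+ 4
  - (2 * n ^+ 3 + 6 * n ^+ 2 + 10 * n + 10) * x ^+ 3
  + (n ^+ 4 + 5 * n ^+ 3 + 11 * n ^+ 2 + 15 * n + 5) * x ^+ 2
  + (n ^+ 3 + 4 * n ^+ 2 + 10 * n + 10) * x + 1).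

Lemma lehmer_step_neq0 : 1 + (n + 2) * x != 0.
Proof.
apply: contra (expf_neq0 2 D_neq0) => /eqP h0; rewrite /D /lehmer_den.
(* The cofactor is the product of the four other conjugates of [1 + (n + 2) x], reduced to degree 4
   in [x]. *)
suff -> : (n ^+ 3 + 5 * n ^+ 2 + 10 * n + 7) ^+ 2 = (1 + (n + 2) * x) *
  ((n ^+ 6 + 11 * n ^+ 5 + 55 * n ^+ 4 + 154 * n ^+ 3 + 250 * n ^+ 2
    + 220 * n + 81)
   + (n ^+ 8 + 13 * n ^+ 7 + 77 * n ^+ 6 + 273 * n ^+ 5 + 636 * n ^+ 4
      + 994 * n ^+ 3 + 1008 * n ^+ 2 + 599 * n + 158) * x
   + (- 2 * n ^+ 7 - 22 * n ^+ 6 - 107 * n ^+ 5 - 304 * n ^+ 4 - 556 * n ^+ 3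
      - 663 * n ^+ 2 - 476 * n - 156) * x ^+ 2
   + (n ^+ 6 + 8 * n ^+ 5 + 24 * n ^+ 4 + 31 * n ^+ 3 + 10 * n ^+ 2 - 12 * n
      - 8) * x ^+ 3
   + (n ^+ 4 + 8 * n ^+ 3 + 24 * n ^+ 2 + 32 * n + 16) * x ^+ 4).
  by rewrite h0 mul0r.
ring: hx.
Qed.

Lemma lehmer_step0 : (1 + (n + 2) * x) * r1 = n + 2 + n * x - x ^+ 2.
Proof.
rewrite /r1 mulrA; apply/(canLR (mulfK D_neq0)).
rewrite /D /lehmer_den /lehmer_num1; ring: hx.
Qed.

Let step (p q : F) :
  (D + (n + 2) * p) * q = (n + 2) * D ^+ 2 + n * p * D - p ^+ 2 ->
  (1 + (n + 2) * (p / D)) * (q / D) = n + 2 + n * (p / D) - (p / D) ^+ 2.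
Proof.
move=> h; apply: (mulIf (expf_neq0 2 D_neq0)); move: D_neq0 h.
move: D => d d0 h; transitivity ((d + (n + 2) * p) * q); first by field.
by rewrite h; field.
Qed.

Lemma lehmer_step1 : (1 + (n + 2) * r1) * r2 = n + 2 + n * r1 - r1 ^+ 2.
Proof.
by apply: step; rewrite /D /lehmer_den /lehmer_num1 /lehmer_num2; ring: hx.
Qed.

Lemma lehmer_step2 : (1 + (n + 2) * r2) * r3 = n + 2 + n * r2 - r2 ^+ 2.
Proof.
by apply: step; rewrite /D /lehmer_den /lehmer_num2 /lehmer_num3; ring: hx.
Qed.

Lemma lehmer_step3 : (1 + (n + 2) * r3) * r4 = n + 2 + n * r3 - r3 ^+ 2.
Proof.
by apply: step; rewrite /D /lehmer_den /lehmer_num3 /lehmer_num4; ring: hx.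
Qed.

Lemma lehmer_step4 : (1 + (n + 2) * r4) * x = n + 2 + n * r4 - r4 ^+ 2.
Proof.
have -> : x = x * D / D by rewrite mulfK.
by apply: step; rewrite /D /lehmer_den /lehmer_num4; ring: hx.
Qed.

Lemma lehmer_trace : x + r1 + r2 + r3 + r4 = - n ^+ 2.
Proof.
apply: (mulIf D_neq0); rewrite !mulrDl !divfK //.
rewrite /D /lehmer_den /lehmer_num1 /lehmer_num2 /lehmer_num3 /lehmer_num4.
ring.
Qed.

(** The left side is the coefficient of [z^0] in [tau(z)^2]. The other coefficients are its
    conjugates, so this one identity yields the whole formula for [tau(z)^2]. *)
Lemma lehmer_square :
  x ^+ 2 + 2 * r1 * r4 + 2 * r2 * r3
  = - (n + 1) ^+ 2 * x + (2 * n + 4) * r1 + (n - 1) * r2 - r3 - (n + 1) * r4.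
Proof.
apply: (mulIf (expf_neq0 2 D_neq0)).
transitivity (x ^+ 2 * D ^+ 2 + 2 * lehmer_num1 n x * lehmer_num4 n x
   + 2 * lehmer_num2 n x * lehmer_num3 n x).
  by rewrite /r1 /r2 /r3 /r4; move: D_neq0; move: D => d d0; field.
transitivity ((- (n + 1) ^+ 2 * x * D + (2 * n + 4) * lehmer_num1 n x
  + (n - 1) * lehmer_num2 n x - lehmer_num3 n x
  - (n + 1) * lehmer_num4 n x) * D); last first.
  by rewrite /r1 /r2 /r3 /r4; move: D_neq0; move: D => d d0; field.
rewrite /D /lehmer_den /lehmer_num1 /lehmer_num2 /lehmer_num3 /lehmer_num4.
ring: hx.
Qed.

Lemma lehmer_prod1 :
  x * r1 + r1 * r2 + r2 * r3 + r3 * r4 + r4 * x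
  = - (n ^+ 3 + 3 * n ^+ 2 + 5 * n + 5).
Proof.
apply: (mulIf (expf_neq0 2 D_neq0)).
transitivity (x * D * lehmer_num1 n x + lehmer_num1 n x * lehmer_num2 n x
  + lehmer_num2 n x * lehmer_num3 n x + lehmer_num3 n x * lehmer_num4 n x
  + lehmer_num4 n x * D * x).
  by rewrite /r1 /r2 /r3 /r4; move: D_neq0; move: D => d d0; field.
rewrite /D /lehmer_den /lehmer_num1 /lehmer_num2 /lehmer_num3 /lehmer_num4.
ring: hx.
Qed.

Lemma lehmer_prod2 :
  x * r2 + r1 * r3 + r2 * r4 + r3 * x + r4 * r1
  = - (n ^+ 3 + 3 * n ^+ 2 + 5 * n + 5).
Proof.
apply: (mulIf (expf_neq0 2 D_neq0)).
transitivity (x * D * lehmer_num2 n x + lehmer_num1 n x * lehmer_num3 n x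
  + lehmer_num2 n x * lehmer_num4 n x + lehmer_num3 n x * D * x
  + lehmer_num4 n x * lehmer_num1 n x).
  by rewrite /r1 /r2 /r3 /r4; move: D_neq0; move: D => d d0; field.
rewrite /D /lehmer_den /lehmer_num1 /lehmer_num2 /lehmer_num3 /lehmer_num4.
ring: hx.
Qed.

End LehmerConjugates.

(** * The ring [Z[z]] *)

Section CyclotomicIntegers.

Implicit Types (z x y : algC) (k : int).

Lemma prim5_expr5 z : 5.-primitive_root z -> z ^+ 5 = 1.
Proof. exact: prim_expr_order. Qed.

Lemma prim5_neq1 z : 5.-primitive_root z -> z != 1.
Proof.
by move=> hz; rewrite -(expr1 z) -(expr0 z) (eq_prim_root_expr hz).
Qed.

Lemma prim5_expr4 z : 5.-primitive_root z ->
  z ^+ 4 = - (1 + z + z ^+ 2 + z ^+ 3).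
Proof.
move=> hz; apply/eqP; rewrite -subr_eq0 opprK; apply/eqP.
have h1 : z - 1 != 0 by rewrite subr_eq0 prim5_neq1.
by apply: (mulfI h1); rewrite mulr0; ring: (prim5_expr5 hz).
Qed.

Lemma prim5_exp z (j : nat) : 5.-primitive_root z -> coprime j 5 ->
  5.-primitive_root (z ^+ j).
Proof. by move=> hz hj; rewrite (prim_root_exp_coprime _ hz). Qed.

Lemma prim5_neq0 z : 5.-primitive_root z -> z != 0.
Proof.
move=> /prim5_expr5 h; apply/eqP => z0; move/eqP: h.
by rewrite z0 expr0n eq_sym oner_eq0.
Qed.

Lemma Zadj_int z k : Zadj z k%:~R.
Proof. by exists k%:P; rewrite map_polyC hornerC. Qed.

Lemma Zadj_nat z (k : nat) : Zadj z k%:R.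
Proof. exact: (Zadj_int z k). Qed.

Lemma Zadj1 z : Zadj z 1.
Proof. exact: (Zadj_int z 1). Qed.

Lemma Zadj_gen z : Zadj z z.
Proof. by exists 'X; rewrite map_polyX hornerX. Qed.

Lemma ZadjD z x y : Zadj z x -> Zadj z y -> Zadj z (x + y).
Proof.
by move=> [p ->] [q ->]; exists (p + q); rewrite rmorphD hornerD.
Qed.

Lemma ZadjN z x : Zadj z x -> Zadj z (- x).
Proof. by move=> [p ->]; exists (- p); rewrite rmorphN hornerN. Qed.

Lemma ZadjB z x y : Zadj z x -> Zadj z y -> Zadj z (x - y).
Proof. by move=> hx hy; apply: ZadjD => //; apply: ZadjN. Qed.

Lemma ZadjM z x y : Zadj z x -> Zadj z y -> Zadj z (x * y).
Proof.
by move=> [p ->] [q ->]; exists (p * q); rewrite rmorphM hornerM.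
Qed.

Lemma ZadjX z x (j : nat) : Zadj z x -> Zadj z (x ^+ j).
Proof.
by move=> [p ->]; exists (p ^+ j); rewrite rmorphXn horner_exp.
Qed.

Lemma Zadj_prod z (I : eqType) (s : seq I) (f : I -> algC) :
  (forall i, i \in s -> Zadj z (f i)) -> Zadj z (\prod_(i <- s) f i).
Proof.
elim: s => [|i s IH] h; first by rewrite big_nil; apply: Zadj1.
rewrite big_cons; apply: ZadjM; first by apply: h; rewrite mem_head.
by apply: IH => j js; apply: h; rewrite in_cons js orbT.
Qed.

Lemma ZadjP z x : 5.-primitive_root z ->
  Zadj z x <-> exists x0 x1 x2 x3 : int,
    x = x0%:~R + x1%:~R * z + x2%:~R * z ^+ 2 + x3%:~R * z ^+ 3.
Proof.
move=> hz; split=> [[p ->]|[x0 [x1 [x2 [x3 ->]]]]]; last first.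
  have hg := Zadj_gen z.
  by do !apply: ZadjD; do ?[exact: Zadj_int | apply: ZadjM | exact: ZadjX].
elim/poly_ind: p => [|p c [x0 [x1 [x2 [x3 hp]]]]].
  by exists 0, 0, 0, 0; rewrite rmorph0 horner0; ring.
exists (c - x3), (x0 - x3), (x1 - x3), (x2 - x3).
rewrite rmorphD rmorphM /= map_polyX map_polyC hornerMXaddC hp.
by rewrite !intrB; ring: (prim5_expr4 hz).
Qed.

Lemma Zadj_expr z (j : nat) x : Zadj (z ^+ j) x -> Zadj z x.
Proof.
move=> [p ->]; exists (p \Po 'X^j).
by rewrite map_comp_poly horner_comp map_polyXn hornerXn.
Qed.

Lemma Zadj_Aint z x : 5.-primitive_root z -> Zadj z x -> x \in Aint.
Proof.
move=> hz [p ->]; apply: rpred_horner (Aint_prim_root hz).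
by apply/polyOverP => i; rewrite coef_map; apply: Aint_int.
Qed.

(** Automorphisms of all of [algC], so that they preserve [Aint]; on [Z[z]] they act as the Galois
    group of [Q(z)], and their composites are controlled only there ([aut_comp]). *)
Definition aut2 : {rmorphism algC -> algC} :=
  sval (Qn_aut_exists (isT : coprime 2 5)).
Definition aut3 : {rmorphism algC -> algC} :=
  sval (Qn_aut_exists (isT : coprime 3 5)).
Definition aut4 : {rmorphism algC -> algC} :=
  sval (Qn_aut_exists (isT : coprime 4 5)).

Lemma aut2E z : 5.-primitive_root z -> aut2 z = z ^+ 2.
Proof.
by move=> hz; apply: (svalP (Qn_aut_exists (isT : coprime 2 5)));
  apply: prim5_expr5.
Qed.

Lemma aut3E z : 5.-primitive_root z -> aut3 z = z ^+ 3.
Proof.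
by move=> hz; apply: (svalP (Qn_aut_exists (isT : coprime 3 5)));
  apply: prim5_expr5.
Qed.

Lemma aut4E z : 5.-primitive_root z -> aut4 z = z ^+ 4.
Proof.
by move=> hz; apply: (svalP (Qn_aut_exists (isT : coprime 4 5)));
  apply: prim5_expr5.
Qed.

Lemma Zadj_aut (u : {rmorphism algC -> algC}) z (j : nat) x :
  u z = z ^+ j -> Zadj z x -> Zadj z (u x).
Proof.
move=> uz [p ->]; apply: (@Zadj_expr _ j); exists p.
rewrite -horner_map /= uz -map_poly_comp; congr (_.[_]).
by apply: eq_map_poly => i /=; rewrite rmorph_int.
Qed.

Lemma Zadj_aut2 z x : 5.-primitive_root z -> Zadj z x -> Zadj z (aut2 x).
Proof. by move=> hz; apply: Zadj_aut (aut2E hz). Qed.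

Lemma Zadj_aut3 z x : 5.-primitive_root z -> Zadj z x -> Zadj z (aut3 x).
Proof. by move=> hz; apply: Zadj_aut (aut3E hz). Qed.

Lemma Zadj_aut4 z x : 5.-primitive_root z -> Zadj z x -> Zadj z (aut4 x).
Proof. by move=> hz; apply: Zadj_aut (aut4E hz). Qed.

Definition cnorm x : algC := x * aut2 x * aut3 x * aut4 x.

Lemma cnormM x y : cnorm (x * y) = cnorm x * cnorm y.
Proof. by rewrite /cnorm !rmorphM /=; ring. Qed.

Lemma cnorm_nat (j : nat) : cnorm j%:R = j%:R ^+ 4.
Proof. by rewrite /cnorm !rmorph_nat; ring. Qed.

Lemma cnorm1 : cnorm 1 = 1.
Proof. by rewrite /cnorm !rmorph1; ring. Qed.

Section Coordinates.

Variable z : algC.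
Variables x0 x1 x2 x3 : algC.
Let x := x0 + x1 * z + x2 * z ^+ 2 + x3 * z ^+ 3.

Lemma aut_coord (u : {rmorphism algC -> algC}) (j : nat) :
    u z = z ^+ j -> u x0 = x0 -> u x1 = x1 -> u x2 = x2 -> u x3 = x3 ->
  u x = x0 + x1 * z ^+ j + x2 * (z ^+ j) ^+ 2 + x3 * (z ^+ j) ^+ 3.
Proof.
by move=> uz h0 h1 h2 h3; rewrite /x !(rmorphD, rmorphM, rmorphXn) /= uz
  h0 h1 h2 h3.
Qed.

End Coordinates.

Lemma aut_icoord (u : {rmorphism algC -> algC}) z (j : nat)
    (x0 x1 x2 x3 : int) : u z = z ^+ j ->
  u (x0%:~R + x1%:~R * z + x2%:~R * z ^+ 2 + x3%:~R * z ^+ 3)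
  = x0%:~R + x1%:~R * z ^+ j + x2%:~R * (z ^+ j) ^+ 2
    + x3%:~R * (z ^+ j) ^+ 3.
Proof. by move=> uz; apply: aut_coord; rewrite ?rmorph_int. Qed.

(* The relative norm to the real subfield is [p + q (z + z^4)]. *)
Lemma cnorm_coord z (x0 x1 x2 x3 : int) : 5.-primitive_root z ->
  let p := x0 ^+ 2 + x1 ^+ 2 + x2 ^+ 2 + x3 ^+ 2
           - (x0 * x2 + x1 * x3 + x0 * x3) in
  let q := x0 * x1 + x1 * x2 + x2 * x3 - (x0 * x2 + x1 * x3 + x0 * x3) in
  cnorm (x0%:~R + x1%:~R * z + x2%:~R * z ^+ 2 + x3%:~R * z ^+ 3)
  = (p ^+ 2 - p * q - q ^+ 2)%:~R.
Proof.
move=> hz p q; rewrite /cnorm (aut_icoord _ _ _ _ (aut2E hz)).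
rewrite (aut_icoord _ _ _ _ (aut3E hz)) (aut_icoord _ _ _ _ (aut4E hz)).
rewrite /p /q !(intrB, intrD, intrM, rmorphXn) /=.
by ring: (prim5_expr4 hz).
Qed.

(** On [Z[z]], [aut4] is complex conjugation and [aut3] is the conjugate of [aut2], so the norm is a
    product of two squared absolute values. *)
Lemma cnorm_ge0 z x : 5.-primitive_root z -> Zadj z x -> 0 <= cnorm x.
Proof.
move=> hz /(ZadjP _ hz)[x0 [x1 [x2 [x3 ->]]]].
set w := _ + _ + _ + _.
have zc : z^* = z ^+ 4.
  apply: (mulfI (prim5_neq0 hz)); rewrite -normCK -exprS prim5_expr5 //.
  suff /eqP-> : `|z| == 1 by rewrite expr1n.
  by rewrite -(@pexpr_eq1 _ _ 5) // -normrX prim5_expr5 // normr1.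
have h4 : aut4 w = w^*.
  rewrite (aut_icoord _ _ _ _ (aut4E hz)) /w !(rmorphD, rmorphM, rmorphXn) /=.
  by rewrite zc !rmorph_int.
have h3 : aut3 w = (aut2 w)^*.
  rewrite (aut_icoord _ _ _ _ (aut3E hz)) (aut_icoord _ _ _ _ (aut2E hz)).
  rewrite !(rmorphD, rmorphM, rmorphXn) /= zc !rmorph_int.
  by ring: (prim5_expr5 hz).
rewrite /cnorm h4 h3.
have -> : w * aut2 w * (aut2 w)^* * w^* = (w * w^*) * (aut2 w * (aut2 w)^*).
  by ring.
by rewrite -!normCK mulr_ge0 // exprn_ge0.
Qed.

Lemma Zadj_cnorm z x : 5.-primitive_root z -> Zadj z x ->
  exists N : nat, cnorm x = N%:R.
Proof.
move=> hz hx; have := cnorm_ge0 hz hx.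
case/(ZadjP _ hz): hx => [x0 [x1 [x2 [x3 ->]]]].
rewrite (cnorm_coord _ _ _ _ hz) /=.
by set N := (X in X%:~R); rewrite ler0z; case: N => // N _; exists N.
Qed.

Lemma Zadj_residue z x : 5.-primitive_root z -> Zadj z x ->
  exists w : int, Zadj_dvd z (1 - z) (x - w%:~R) /\
    forall N : nat, cnorm x = N%:R -> (N%:Z == w ^+ 4 %[mod 5])%Z.
Proof.
move=> hz /(ZadjP _ hz)[x0 [x1 [x2 [x3 ->]]]].
exists (x0 + x1 + x2 + x3); split.
  exists (- (x1%:~R + x2%:~R * (1 + z) + x3%:~R * (1 + z + z ^+ 2))).
    have hg := Zadj_gen z; have h1 := Zadj1 z.
    by apply: ZadjN; do !apply: ZadjD; do ?[exact: Zadj_int];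
       apply: ZadjM; do ?[exact: Zadj_int]; do !apply: ZadjD => //;
       apply: ZadjX.
  by rewrite !intrD; ring.
move=> N; rewrite (cnorm_coord _ _ _ _ hz) /= => /eqP; rewrite -[N%:R]/(N%:Z%:~R).
rewrite eqr_int => /eqP <-; rewrite eqz_mod_dvd.
(* In the notation of [cnorm_coord], [p = s0 - s2] and [q = s1 - s2]. Modulo 5 the norm is
   [(p + 2q)^2], and [p + 2q] is [s0 + 2 s1 + 2 s2], the square of the coordinate sum. *)
set s0 := x0 ^+ 2 + _ + _ + _; set s2 := x0 * x2 + _ + _.
set s1 := x0 * x1 + _ + _.
have -> : (x0 + x1 + x2 + x3) ^+ 4 = (s0 + 2 * s1 + 2 * s2) ^+ 2.
  by rewrite /s0 /s1 /s2; ring.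
apply/dvdzP; exists (- (s1 ^+ 2 + s2 ^+ 2 + s0 * s1 + s0 * s2 + s1 * s2)).
ring.
Qed.

End CyclotomicIntegers.

(** * Prime factors of [A_n] *)

Ltac zadj := do ?[assumption | exact: Zadj_gen | exact: Zadj1 | exact: Zadj_nat
  | exact: Zadj_int | apply: ZadjB | apply: ZadjD | apply: ZadjN
  | apply: ZadjX | apply: ZadjM].

Section PrimeFactors.

Variable z : algC.
Hypothesis hz : 5.-primitive_root z.
Implicit Types (x y u v w t pi lam : algC).

Lemma Zadj_dvd_refl x : Zadj_dvd z x x.
Proof. by exists 1; [apply: Zadj1 | rewrite mul1r]. Qed.

Lemma Zadj_dvd_trans y x t : Zadj_dvd z x y -> Zadj_dvd z y t ->
  Zadj_dvd z x t.
Proof.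
by move=> [q hq ->] [r hr ->]; exists (r * q); [apply: ZadjM | rewrite mulrA].
Qed.

Lemma Zadj_dvd_mull x y t : Zadj z t -> Zadj_dvd z x y -> Zadj_dvd z x (t * y).
Proof.
by move=> ht [q hq ->]; exists (t * q); [apply: ZadjM | rewrite mulrA].
Qed.

Lemma Zadj_dvd_mul x y t w : Zadj_dvd z x y -> Zadj_dvd z t w ->
  Zadj_dvd z (x * t) (y * w).
Proof.
by move=> [q hq ->] [r hr ->]; exists (q * r); [apply: ZadjM | ring].
Qed.

Lemma Zadj_dvdD x y t : Zadj_dvd z x y -> Zadj_dvd z x t ->
  Zadj_dvd z x (y + t).
Proof.
by move=> [q hq ->] [r hr ->]; exists (q + r); [apply: ZadjD | rewrite mulrDl].
Qed.

Lemma Zadj_dvdB x y t : Zadj_dvd z x y -> Zadj_dvd z x t ->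
  Zadj_dvd z x (y - t).
Proof.
by move=> [q hq ->] [r hr ->]; exists (q - r); [apply: ZadjB | rewrite mulrBl].
Qed.

Lemma Zadj_dvd_aut (u : {rmorphism algC -> algC}) (j : nat) x y :
  u z = z ^+ j -> Zadj_dvd z x y -> Zadj_dvd z (u x) (u y).
Proof.
by move=> uz [q hq ->]; exists (u q); [apply: Zadj_aut uz hq | rewrite rmorphM].
Qed.

Lemma Zadj_rat_int x : Zadj z x -> x \in Crat -> exists k : int, x = k%:~R.
Proof.
move=> hx rx; have : x \in Num.int.
  by apply: Cint_rat_Aint rx _; apply: Zadj_Aint hx.
by move/intrP.
Qed.

Lemma Zadj_dvd_nat (m k : nat) : Zadj_dvd z m%:R k%:R -> (m %| k)%N.
Proof.
move=> [q hq]; have [->|m0] := eqVneq m 0%N.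
  by rewrite mulr0 => /eqP; rewrite pnatr_eq0 => /eqP->.
move=> e; have m0' : m%:R != 0 :> algC by rewrite pnatr_eq0.
have qE : q = k%:R / m%:R by rewrite e mulfK.
have [j jE] : exists j : int, q = j%:~R.
  by apply: Zadj_rat_int hq _; rewrite qE rpredM ?rpredV ?rpred_nat.
move: e; rewrite jE -[k%:R]/(k%:Z%:~R) -[m%:R]/(m%:Z%:~R) -intrM.
by move/eqP; rewrite eqr_int => /eqP e; apply/(@dvdzP m k); exists j.
Qed.

Lemma dvd_cnorm x y (N M : nat) : Zadj_dvd z x y ->
  cnorm x = N%:R -> cnorm y = M%:R -> (N %| M)%N.
Proof.
move=> [q hq ->]; rewrite cnormM => -> hM; apply: Zadj_dvd_nat.
have [K hK] := Zadj_cnorm hz hq; rewrite hK in hM.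
by exists K%:R; [apply: Zadj_nat | rewrite -hM].
Qed.

Lemma dvd_self_cnorm x : Zadj z x -> Zadj_dvd z x (cnorm x).
Proof.
move=> hx; exists (aut2 x * aut3 x * aut4 x); last by rewrite /cnorm; ring.
by do !apply: ZadjM; [apply: Zadj_aut2|apply: Zadj_aut3|apply: Zadj_aut4].
Qed.

(** Comaximality after inverting 5, which is enough because [Delta_n] is prime to 5. *)
Definition comax5 x y : Prop := exists (k : nat) (u v : algC),
  [/\ Zadj z u, Zadj z v & 5 ^+ k = u * x + v * y].

Lemma comax5_mul x y t : Zadj z x -> Zadj z y -> Zadj z t ->
  comax5 x t -> comax5 y t -> comax5 (x * y) t.
Proof.
move=> hx hy ht [k [u [v [hu hv e]]]] [k' [u' [v' [hu' hv' e']]]].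
exists (k + k')%N, (u * u'), (u * x * v' + v * (u' * y + v' * t)).
split; first exact: ZadjM.
  by do !apply: ZadjD; do !apply: ZadjM => //; do !apply: ZadjD; apply: ZadjM.
by rewrite exprD e e'; ring.
Qed.

Lemma comax5_dvd x y t (k k' : nat) : comax5 x y ->
  Zadj_dvd z x (5 ^+ k * t) -> Zadj_dvd z y (5 ^+ k' * t) ->
  exists j : nat, Zadj_dvd z (x * y) (5 ^+ j * t).
Proof.
move=> [i [u [v [hu hv e]]]] [q hq eq] [r hr er].
exists (i + k + k')%N.
have h5 (j : nat) : Zadj z (5 ^+ j) by apply: ZadjX; apply: Zadj_nat.
exists (u * r * 5 ^+ k + v * q * 5 ^+ k').
  by apply: ZadjD; do !apply: ZadjM.
rewrite !exprD e; transitivity (u * x * 5 ^+ k * (5 ^+ k' * t)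
  + v * y * 5 ^+ k' * (5 ^+ k * t)); first by ring.
by rewrite eq er; ring.
Qed.

Lemma comax5_sub x y w t t' : Zadj z w -> 5 = w * (t - t') ->
  Zadj_dvd z x t -> Zadj_dvd z y t' -> comax5 x y.
Proof.
move=> hw e [q hq eq] [r hr er]; exists 1%N, (w * q), (- (w * r)); split.
- exact: ZadjM.
- by apply: ZadjN; apply: ZadjM.
by rewrite expr1 e eq er; ring.
Qed.

Variable n : int.
Let A := A_ z n.

Lemma Zadj_A : Zadj z A.
Proof.
by rewrite /A /A_; zadj.
Qed.

Lemma aut_A (u : {rmorphism algC -> algC}) (j : nat) :
  u z = z ^+ j -> u A = A_ (z ^+ j) n.
Proof.
move=> uz; rewrite /A /A_ !(rmorphD, rmorphM, rmorphXn) /= uz rmorph_int.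
by rewrite rmorph1.
Qed.

Lemma cnorm_A : cnorm A = (Delta n)%:~R.
Proof.
rewrite /cnorm (aut_A (aut2E hz)) (aut_A (aut3E hz)) (aut_A (aut4E hz)).
rewrite /A /A_ /Delta !(intrD, intrM, rmorphXn) /=.
by ring: (prim5_expr4 hz).
Qed.

Let A2 := A_ (z ^+ 2) n.
Let A3 := A_ (z ^+ 3) n.
Let A4 := A_ (z ^+ 4) n.

(** The differences of conjugates of [A_n] do not involve [n]; each is a unit times a power of
    [1 - z], and the factor shown is the quotient of 5 by it. *)
Lemma A_sub12 : 5 = (- z - 3 * z ^+ 2 - z ^+ 3) * (A - A2).
Proof. by rewrite /A /A2 /A_; ring: (prim5_expr4 hz). Qed.
Lemma A_sub13 : 5 = (- 1 + 2 * z - z ^+ 2) * (A - A3).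
Proof. by rewrite /A /A3 /A_; ring: (prim5_expr4 hz). Qed.
Lemma A_sub14 : 5 = (1 + 2 * z + z ^+ 2 + z ^+ 3) * (A - A4).
Proof. by rewrite /A /A4 /A_; ring: (prim5_expr4 hz). Qed.
Lemma A_sub23 : 5 = (z ^+ 2 - z ^+ 3) * (A2 - A3).
Proof. by rewrite /A2 /A3 /A_; ring: (prim5_expr4 hz). Qed.
Lemma A_sub24 : 5 = (3 + 2 * z + 2 * z ^+ 2 + 3 * z ^+ 3) * (A2 - A4).
Proof. by rewrite /A2 /A4 /A_; ring: (prim5_expr4 hz). Qed.
Lemma A_sub34 : 5 = (- 1 - z + 2 * z ^+ 3) * (A3 - A4).
Proof. by rewrite /A3 /A4 /A_; ring: (prim5_expr4 hz). Qed.

Hypothesis h5 : ~~ (5 %| Delta n)%Z.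

Lemma Delta_nat : exists N : nat, Delta n = N /\ ~~ (5 %| N)%N.
Proof.
have [N hN] := Zadj_cnorm hz Zadj_A; exists N.
move: hN; rewrite cnorm_A -[N%:R]/(N%:Z%:~R) => /eqP.
rewrite eqr_int => /eqP hN; split=> //.
by apply: contra h5; rewrite hN => h; apply: h.
Qed.

(** The four conjugates of [pi] divide [p] and are pairwise comaximal away from 5, since they divide
    different conjugates of [A_n]. So their product, the norm, divides [5^k p]. It is prime to 5 as
    a divisor of [Delta_n], and it is not 1 because [pi] is not a unit. *)
Lemma prime_cnorm (p : nat) pi : prime p -> Zadj_prime z pi ->
  Zadj_dvd z pi p%:R -> Zadj_dvd z pi A -> cnorm pi = p%:R.
Proof.
move=> pp [hpi pi0 nu _] hp hA.
have [N hN] := Zadj_cnorm hz hpi.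
have [De [hD D5]] := Delta_nat.
have ND : (N %| De)%N by apply: dvd_cnorm hA hN _; rewrite cnorm_A hD.
have N5 : coprime N 5.
  rewrite coprime_sym prime_coprime //; apply: contra D5 => h.
  exact: dvdn_trans ND.
have h2 := Zadj_dvd_aut (aut2E hz); have h3 := Zadj_dvd_aut (aut3E hz).
have h4 := Zadj_dvd_aut (aut4E hz).
have := h2 _ _ hA; have := h3 _ _ hA; have := h4 _ _ hA.
rewrite (aut_A (aut2E hz)) (aut_A (aut3E hz)) (aut_A (aut4E hz)).
move=> hA4 hA3 hA2.
have := h2 _ _ hp; have := h3 _ _ hp; have := h4 _ _ hp.
rewrite !rmorph_nat => hp4 hp3 hp2.
have z2 := Zadj_aut2 hz hpi; have z3 := Zadj_aut3 hz hpi.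
have z4 := Zadj_aut4 hz hpi.
have lift x : Zadj_dvd z x p%:R -> Zadj_dvd z x (5 ^+ 0 * p%:R).
  by rewrite expr0 mul1r.
have c12 : comax5 pi (aut2 pi) by apply: comax5_sub A_sub12 hA hA2; zadj.
have c13 : comax5 pi (aut3 pi) by apply: comax5_sub A_sub13 hA hA3; zadj.
have c14 : comax5 pi (aut4 pi) by apply: comax5_sub A_sub14 hA hA4; zadj.
have c23 : comax5 (aut2 pi) (aut3 pi).
  by apply: comax5_sub A_sub23 hA2 hA3; zadj.
have c24 : comax5 (aut2 pi) (aut4 pi).
  by apply: comax5_sub A_sub24 hA2 hA4; zadj.
have c34 : comax5 (aut3 pi) (aut4 pi).
  by apply: comax5_sub A_sub34 hA3 hA4; zadj.
have [k1 d1] := comax5_dvd c12 (lift _ hp) (lift _ hp2).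
have [k2 d2] := comax5_dvd (comax5_mul hpi z2 z3 c13 c23) d1 (lift _ hp3).
have z12 := ZadjM hpi z2; have z123 := ZadjM z12 z3.
have c4 := comax5_mul z12 z3 z4 (comax5_mul hpi z2 z4 c14 c24) c34.
have [k d] := comax5_dvd c4 d2 (lift _ hp4).
have {d} : (N %| 5 ^ k * p)%N.
  by apply: Zadj_dvd_nat; rewrite natrM natrX -hN.
rewrite Gauss_dvdr ?coprimeXr // => Np.
case/primeP: pp => _ /(_ _ Np) /orP[] /eqP NE; last by rewrite hN NE.
by case: nu; have := dvd_self_cnorm hpi; rewrite hN NE.
Qed.

Lemma prime_dvd_exp pi x (k : nat) : Zadj_prime z pi -> Zadj z x ->
  Zadj_dvd z pi (x ^+ k) -> Zadj_dvd z pi x.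
Proof.
move=> [hpi _ nu pr] hx; elim: k => [|k IH]; first by rewrite expr0.
by rewrite exprS => /(pr _ _ hx (ZadjX k hx))[].
Qed.

(** Otherwise [pi] divides 5, and taking norms forces [p = 5], although [p] divides [Delta_n]. *)
Lemma prime_ndvd_conj (p : nat) pi w t : prime p -> Zadj_prime z pi ->
  Zadj_dvd z pi p%:R -> Zadj_dvd z pi A ->
  Zadj z w -> 5 = w * (A - t) -> ~ Zadj_dvd z pi t.
Proof.
move=> pp hpi hp hA hw e ht.
have hN := prime_cnorm pp hpi hp hA.
have [De [hD D5]] := Delta_nat.
have pD : (p %| De)%N by apply: dvd_cnorm hA hN _; rewrite cnorm_A hD.
have : (p %| 5 ^ 4)%N.
  apply: (dvd_cnorm _ hN (y := 5)); last by rewrite cnorm_nat natrX.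
  by rewrite e; apply: Zadj_dvd_mull => //; apply: Zadj_dvdB.
rewrite Euclid_dvdX // andbT dvdn_prime2 // => /eqP p5.
by move: D5; rewrite -p5 pD.
Qed.

(** This is [normalized_factor] stripped of its unit and tied to [A_n]. Since [B_n] and [C_n] are
    [A_n] for the roots [z^3] and [z^2], varying [z] covers all three factors of [alpha]. *)
Definition is_factor (N : nat) lam : Prop :=
  exists s : seq (nat * algC),
  [/\ N = (\prod_(q <- s) q.1)%N, lam = \prod_(q <- s) q.2 &
      forall q : nat * algC, q \in s -> [/\ prime q.1, Zadj_prime z q.2,
        Zadj_dvd z q.2 q.1%:R & Zadj_dvd z q.2 A]].

Lemma is_factor_Zadj N lam : is_factor N lam -> Zadj z lam.
Proof.
by move=> [s [_ -> hs]]; apply: Zadj_prod => q /hs[_ []].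
Qed.

Lemma is_factor_mul N lam N' lam' : is_factor N lam -> is_factor N' lam' ->
  is_factor (N * N') (lam * lam').
Proof.
move=> [s [-> -> hs]] [s' [-> -> hs']]; exists (s ++ s').
rewrite !big_cat; split=> // x; rewrite mem_cat => /orP[]; [exact: hs|exact: hs'].
Qed.

Lemma is_factor1 : is_factor 1 1.
Proof. by exists [::]; rewrite !big_nil. Qed.

Lemma is_factorX N lam (k : nat) : is_factor N lam ->
  is_factor (N ^ k) (lam ^+ k).
Proof.
move=> h; elim: k => [|k IH]; first exact: is_factor1.
by rewrite expnS exprS; apply: is_factor_mul.
Qed.

Lemma is_factor_cnorm N lam : is_factor N lam -> cnorm lam = N%:R.
Proof.
move=> [s [-> -> hs]]; elim: s hs => [|x s IH] hs.
  by rewrite !big_nil cnorm1.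
rewrite !big_cons cnormM natrM IH => [|y ys]; last first.
  by apply: hs; rewrite in_cons ys orbT.
by case: (hs x (mem_head _ _)) => *; rewrite (@prime_cnorm x.1).
Qed.

Lemma is_factor_dvd_exp N lam : is_factor N lam ->
  exists k : nat, Zadj_dvd z lam (A ^+ k).
Proof.
move=> [s [_ -> hs]]; exists (size s); elim: s hs => [|x s IH] hs.
  by rewrite big_nil; apply: Zadj_dvd_refl.
rewrite big_cons exprS; apply: Zadj_dvd_mul.
  by case: (hs x (mem_head _ _)).
by apply: IH => y ys; apply: hs; rewrite in_cons ys orbT.
Qed.

(** Serves to extract elements of norm [b], [c], [d] and [e] from the single given list of primes
    above [b c^2 d^3 e^3]. *)
Lemma is_factor_sub N lam (K : nat) : is_factor N lam -> (K %| N)%N ->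
  exists lam', is_factor K lam'.
Proof.
move=> [s [-> _ hs]]; elim: s K hs => [|x s IH] K hs.
  by rewrite big_nil dvdn1 => /eqP->; exists 1; apply: is_factor1.
have hx := hs x (mem_head _ _); have [px _ _ _] := hx.
have hs' q (qs : q \in s) := hs q (mem_behead (s := x :: s) qs).
rewrite big_cons; case: (boolP (x.1 %| K)%N) => [/dvdnP[K' ->]|nx].
  rewrite mulnC dvdn_pmul2l ?prime_gt0 // => /(IH _ hs')[lam' h'].
  exists (x.2 * lam'); apply: is_factor_mul h'; exists [:: x].
  by rewrite !big_seq1; split=> // y; rewrite inE => /eqP->.
rewrite Gauss_dvdr; first exact: IH hs'.
by rewrite coprime_sym prime_coprime.
Qed.

(* Only the prime above [A] among the four conjugate primes above [p] can
   divide [x], so the power of [p] in the norm of [x] is carried by it. *)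
Lemma is_factor_dvd N lam x (k Nx : nat) : is_factor N lam ->
  Zadj z x -> Zadj_dvd z x (A ^+ k) -> cnorm x = Nx%:R -> (N %| Nx)%N ->
  Zadj_dvd z lam x.
Proof.
move=> [s [-> -> hs]] hx hxA hNx.
elim: s hs => [|[p pi] s IH] hs.
  by rewrite !big_nil => _; exists x; rewrite ?mulr1.
have [/= pp hpi hp hA] := hs _ (mem_head _ _).
have hs' q (qs : q \in s) := hs q (mem_behead (s := (p, pi) :: s) qs).
rewrite !big_cons /= => hd.
have [x' hx' xE] := IH hs' (dvdn_trans (dvdn_mull _ (dvdnn _)) hd).
have [M hM] := Zadj_cnorm hz hx'.
set N' := (\prod_(j <- s) j.1)%N in hd.
have N'0 : (0 < N')%N.
  by rewrite /N' big_seq; apply: prodn_cond_gt0 => q /hs'[] /prime_gt0.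
have hN' : cnorm (\prod_(j <- s) j.2) = N'%:R.
  by apply: is_factor_cnorm; exists s; split.
have pM : (p %| M)%N.
  move: hNx; rewrite xE cnormM hM hN' -natrM => /eqP; rewrite eqr_nat => /eqP e.
  by move: hd; rewrite -e dvdn_pmul2r.
have : Zadj_dvd z pi (cnorm x').
  rewrite hM; apply: Zadj_dvd_trans hp _; case/dvdnP: pM => q ->.
  by exists q%:R; [apply: Zadj_nat | rewrite natrM].
have [_ _ _ pr] := hpi.
have no (u : {rmorphism algC -> algC}) (j : nat) w : u z = z ^+ j -> Zadj z w ->
    5 = w * (A - A_ (z ^+ j) n) -> ~ Zadj_dvd z pi (u x').
  move=> uz hw e hu; apply: (prime_ndvd_conj pp hpi hp hA hw e).
  rewrite -(aut_A uz); apply: (@prime_dvd_exp _ _ k) => //.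
    by apply: Zadj_aut uz Zadj_A.
  rewrite -rmorphXn; apply: Zadj_dvd_trans hu _.
  apply: (Zadj_dvd_aut uz); apply: Zadj_dvd_trans hxA.
  rewrite xE mulrC; apply: Zadj_dvd_mull (Zadj_dvd_refl _).
  by apply: Zadj_prod => y /hs'[_ []].
have z2 := Zadj_aut2 hz hx'; have z3 := Zadj_aut3 hz hx'.
have z4 := Zadj_aut4 hz hx'.
rewrite /cnorm => /(pr _ _ (ZadjM (ZadjM hx' z2) z3) z4)[]; last first.
  by move=> h; case: (no _ _ _ (aut4E hz) _ A_sub14 h); zadj.
move/(pr _ _ (ZadjM hx' z2) z3)=> []; last first.
  by move=> h; case: (no _ _ _ (aut3E hz) _ A_sub13 h); zadj.
move/(pr _ _ hx' z2)=> []; last first.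
  by move=> h; case: (no _ _ _ (aut2E hz) _ A_sub12 h); zadj.
move=> hd'; rewrite xE mulrC; rewrite mulrC.
by apply: Zadj_dvd_mul hd' (Zadj_dvd_refl _).
Qed.

End PrimeFactors.

Lemma Delta_ndvd5 (n : int) : ~~ (5 %| n)%Z -> ~~ (5 %| Delta n)%Z.
Proof.
apply: contra => h; have : (5 %| n ^+ 4)%Z.
  have -> : n ^+ 4 = Delta n - 5 * (n ^+ 3 + 3 * n ^+ 2 + 5 * n + 5).
    by rewrite /Delta; ring.
  by rewrite rpredB // dvdz_mulr.
by rewrite !dvdzE abszX Euclid_dvdX // andbT.
Qed.

Lemma modz5_ord (w : int) : exists r : 'I_5, (w %% 5)%Z = r.
Proof.
have h0 : 0 <= (w %% 5)%Z by rewrite modz_ge0.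
have h1 : (w %% 5)%Z < 5 by rewrite ltz_mod.
by case: (w %% 5)%Z h0 h1 => // r _ hr; exists (Ordinal (hr : (r < 5)%N)).
Qed.

(** * The units [u_lambda] and residues modulo [1 - z] *)

Section NormalizedFactors.

Variable z : algC.
Hypothesis hz : 5.-primitive_root z.

Lemma five_dvd : Zadj_dvd z (1 - z) 5.
Proof.
exists (4 + 3 * z + 2 * z ^+ 2 + z ^+ 3); last by ring: (prim5_expr4 hz).
by zadj.
Qed.

(** Which sign relates [sqrtC 5] to [1 + 2 (z + z^4)] depends on [z], so both are treated. In either
    case [2 golden = 1 + sqrtC 5] is 1 modulo [1 - z], hence [golden] is 3, that is -2. *)
Lemma golden_Zadj : Zadj z golden /\ Zadj_dvd z (1 - z) (golden + 2).
Proof.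
pose om := z + z ^+ 4.
have s5 : (sqrtC 5 == 1 + 2 * om :> algC) || (sqrtC 5 == - (1 + 2 * om)).
  by rewrite -eqf_sqr sqrtCK; apply/eqP; rewrite /om; ring: (prim5_expr4 hz).
have h2 : (2 : algC) != 0 by rewrite pnatr_eq0.
rewrite /golden; case/orP: s5 => /eqP->.
  have -> : (1 + (1 + 2 * om)) / 2 = 1 + om by field.
  split; first by rewrite /om; zadj.
  exists (4 + 3 * z + 2 * z ^+ 2 + z ^+ 3 - 1 - (1 + z + z ^+ 2 + z ^+ 3)).
    by zadj.
  by rewrite /om; ring: (prim5_expr4 hz).
have -> : (1 + - (1 + 2 * om)) / 2 = - om by field.
split; first by rewrite /om; zadj.
exists (1 + (1 + z + z ^+ 2 + z ^+ 3)); first by zadj.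
by rewrite /om; ring: (prim5_expr4 hz).
Qed.

Lemma golden_unit : golden * (golden - 1) = 1.
Proof.
have h5 : sqrtC 5 ^+ 2 = 5 :> algC by rewrite sqrtCK.
by rewrite /golden; field: h5.
Qed.

(** As [golden] is -2 modulo [1 - z], its product with 2 is -4, that is 1; so [u] always cancels the
    residue of [lam]. The inverse of [golden] is [golden - 1]. *)
Lemma residue_unitP lam u : Zadj z lam -> residue_unit z lam u ->
  exists v, [/\ Zadj z u, Zadj z v, u * v = 1 &
                Zadj_dvd z (1 - z) (u * lam - 1)].
Proof.
have [hg [r hr er]] := golden_Zadj; have [f hf ef] := five_dvd.
have hu := golden_unit; have hgE : golden = r * (1 - z) - 2 by rewrite -er; ring.
rewrite /residue_unit; move: golden hg er hu hgE => g hg er hu hgE hl.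
case=> [[[q hq e] ->]|[[q hq e] ->]|[[q hq e] ->]|[[q hq e] ->]].
- by exists 1; split; zadj; [ring | exists q => //; rewrite mul1r].
- exists (-1); split; zadj; first by ring.
  exists (- q); first by zadj.
  by rewrite [RHS]mulNr -e; ring.
- exists (g - 1); split; zadj => //.
  exists (g * q + 2 * r - f); first by zadj.
  have -> : lam = q * (1 - z) + 2 by rewrite -e; ring.
  transitivity (g * q * (1 - z) + 2 * g - 1); first by ring.
  transitivity (g * q * (1 - z) + 2 * (r * (1 - z)) - f * (1 - z)).
    by rewrite -ef hgE; ring.
  by ring.
exists (1 - g); split; zadj; first by rewrite -[RHS]hu; ring.
exists (- g * q + 2 * r - f); first by zadj.
have -> : lam = q * (1 - z) - 2 by rewrite -e; ring.
transitivity (- g * q * (1 - z) + 2 * g - 1); first by ring.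
transitivity (- g * q * (1 - z) + 2 * (r * (1 - z)) - f * (1 - z)).
  by rewrite -ef {2}hgE; ring.
by ring.
Qed.

Lemma Zadj_dvd_eq z' x y : (forall t, Zadj z t <-> Zadj z' t) ->
  Zadj_dvd z x y <-> Zadj_dvd z' x y.
Proof. by move=> h; split=> [] [q /h hq ->]; exists q. Qed.

Lemma Zadj_prime_eq z' x : (forall t, Zadj z t <-> Zadj z' t) ->
  Zadj_prime z x -> Zadj_prime z' x.
Proof.
move=> h [hx x0 nu pr]; split=> //; first exact/h.
  by move/(Zadj_dvd_eq _ _ h).
move=> y w /h hy /h hw /(Zadj_dvd_eq _ _ h) /(pr _ _ hy hw).
by case=> /(Zadj_dvd_eq _ _ h); [left | right].
Qed.

Lemma Zadj_prim_expr (j k : nat) : (j * k %% 5 = 1)%N ->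
  forall t, Zadj z t <-> Zadj (z ^+ j) t.
Proof.
move=> jk t; split; last exact: Zadj_expr.
by move=> h; apply: (@Zadj_expr _ k); rewrite -exprM -(prim_expr_mod hz) jk.
Qed.

Lemma normalized_factorP n N A alpha (j k : nat) :
  (j * k %% 5 = 1)%N -> A = A_ (z ^+ j) n ->
  normalized_factor z N A alpha ->
  exists lam u v, [/\ is_factor (z ^+ j) n N lam, alpha = u * lam, Zadj z u,
    Zadj z v /\ u * v = 1 & Zadj_dvd z (1 - z) (alpha - 1)].
Proof.
move=> jk -> [s [u [hN hs hr ->]]].
have hl : Zadj z (\prod_(x <- s) x.2) by apply: Zadj_prod => x /hs[_ []].
have [v [hu hv uv hd]] := residue_unitP hl hr.
exists (\prod_(x <- s) x.2), u, v; split=> //.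
exists s; split=> // x /hs[px pix h1 h2]; have h := Zadj_prim_expr jk.
by split=> //; [exact: Zadj_prime_eq h pix|exact/(Zadj_dvd_eq _ _ h)
  |exact/(Zadj_dvd_eq _ _ h)].
Qed.

(** The norm form of [cnorm_coord] is the same polynomial in the coordinates for every primitive
    fifth root of unity. *)
Lemma cnorm_aut (u : {rmorphism algC -> algC}) (j : nat) x :
  u z = z ^+ j -> coprime j 5 -> Zadj z x -> cnorm (u x) = cnorm x.
Proof.
move=> uz hj /(ZadjP _ hz)[x0 [x1 [x2 [x3 ->]]]].
by rewrite (aut_icoord _ _ _ _ uz) !cnorm_coord // prim5_exp.
Qed.

Lemma aut_comp (u u' u'' : {rmorphism algC -> algC}) (j j' j'' : nat) x :
  u z = z ^+ j -> u' z = z ^+ j' -> u'' z = z ^+ j'' ->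
  (j' * j = j'' %[mod 5])%N -> Zadj z x -> u (u' x) = u'' x.
Proof.
move=> uz uz' uz'' hj [p ->]; rewrite -!horner_map /= uz' uz'' -!map_poly_comp.
rewrite rmorphXn /= uz -exprM (mulnC j) -(prim_expr_mod hz) hj (prim_expr_mod hz).
by congr (_.[_]); apply: eq_map_poly => i /=; rewrite !rmorph_int.
Qed.

(** By [Zadj_residue] a norm is a fourth power modulo 5, and Fermat's little theorem applies. *)
Lemma cnorm_mod5 x (N : nat) : Zadj z x -> cnorm x = N%:R -> ~~ (5 %| N)%N ->
  (N %% 5 = 1)%N.
Proof.
move=> hx hN n5; have [w [_ /(_ _ hN)]] := Zadj_residue hz hx.
rewrite -(modzXm 4 w); have [r ->] := modz5_ord w; rewrite modz_nat.
case: r => -[|[|[|[|[|//]]]]] _ /eqP //= [] h //.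
by move: n5; rewrite /dvdn h.
Qed.

End NormalizedFactors.

(** * Factorisation of [alpha] up to units *)

Section AlphaArithmetic.

Variable z : algC.
Hypothesis hz : 5.-primitive_root z.
Variable n : int.
Hypothesis h5 : ~~ (5 %| Delta n)%Z.

(** [lam] divides [x] and has the same norm, so the quotient has norm 1 and its three other
    conjugates multiply to its inverse. *)
Lemma is_factor_assoc N lam x (k : nat) : is_factor z n N lam ->
  Zadj z x -> Zadj_dvd z x (A_ z n ^+ k) -> cnorm x = N%:R -> (0 < N)%N ->
  exists v w, [/\ Zadj z v, Zadj z w, v * w = 1 & lam = v * x].
Proof.
move=> hl hx hxA hN N0.
have [q hq e] := is_factor_dvd hz h5 hl hx hxA hN (dvdnn _).
have := cnormM q lam; rewrite -e hN (is_factor_cnorm hz h5 hl).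
rewrite -{1}[N%:R]mul1r => /mulIf hc.
have {}hc : cnorm q = 1 by rewrite hc // pnatr_eq0 -lt0n.
exists (aut2 q * aut3 q * aut4 q), q; split=> //.
- by do !apply: ZadjM; [apply: Zadj_aut2|apply: Zadj_aut3|apply: Zadj_aut4].
- by rewrite -hc /cnorm; ring.
by rewrite e mulrA -[lam in LHS]mul1r -hc /cnorm; congr (_ * _); ring.
Qed.

End AlphaArithmetic.

Section AlphaArithmeticMain.

Variable z : algC.
Hypothesis hz : 5.-primitive_root z.
Variable n : int.
Hypothesis h5 : ~~ (5 %| Delta n)%Z.
Variables a b c d e : nat.
Hypothesis hpos : [/\ (0 < a)%N, (0 < b)%N, (0 < c)%N, (0 < d)%N & (0 < e)%N].
Hypothesis hDelta : Delta n = (a * b ^ 2 * c ^ 3 * d ^ 4 * e ^ 5)%N%:Z.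

Lemma Delta_ndvd5_factors :
  [/\ ~~ (5 %| a)%N, ~~ (5 %| b)%N, ~~ (5 %| c)%N, ~~ (5 %| d)%N
    & ~~ (5 %| e)%N].
Proof.
have : ~~ (5 %| a * b ^ 2 * c ^ 3 * d ^ 4 * e ^ 5)%N.
  by move: h5; rewrite hDelta dvdzE.
do 4!(rewrite Euclid_dvdM // negb_or Euclid_dvdX // andbT => /andP[+ ?]).
by split.
Qed.

Section Factored.

Variables lam1 lam2 lam3 : algC.
Hypothesis hl1 : is_factor z n (b * c ^ 2 * d ^ 3 * e ^ 3) lam1.
Hypothesis hl2 : is_factor (z ^+ 3) n (b * c * d ^ 2 * e ^ 2) lam2.
Hypothesis hl3 : is_factor (z ^+ 2) n (c * d * e) lam3.

Lemma conj_factor_assoc (u : {rmorphism algC -> algC}) (j k N : nat) lam x :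
  u z = z ^+ j -> (j * k %% 5 = 1)%N -> coprime j 5 -> (0 < N)%N ->
  is_factor (z ^+ j) n N lam -> is_factor z n N x ->
  exists v w, [/\ Zadj z v, Zadj z w, v * w = 1 & lam = v * u x].
Proof.
move=> uz jk hj N0 hl hx.
have hZ := Zadj_prim_expr hz jk.
have [i hi] := is_factor_dvd_exp hx.
have [|||v [w [hv hw vw e0]]] :=
  @is_factor_assoc _ (prim5_exp hz hj) n h5 N lam (u x) i hl _ _ _ N0.
- by apply/hZ/(Zadj_aut uz)/(is_factor_Zadj hx).
- apply/(Zadj_dvd_eq _ _ hZ); rewrite -(aut_A n uz) -rmorphXn.
  exact: Zadj_dvd_aut uz hi.
- by rewrite (cnorm_aut hz uz hj (is_factor_Zadj hx)) (is_factor_cnorm hz h5 hx).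
by exists v, w; split=> //; apply/hZ.
Qed.

(** Choose [b1], [c1], [d1], [e1] above [b], [c], [d], [e] and dividing powers of [A_n]. Up to units
    the three [lam] are monomials in conjugates of these, and [A_n] is [b1^2 c1^3 d1^4 e1^5] times
    an element [a1] of norm [a]. The claims then compare exponents, conjugate by conjugate. *)
Lemma lam_arith :
  let lam := lam1 * lam2 * lam3 in
  [/\ (b * c ^ 2 * d ^ 3 * e ^ 4 %% 5 = 1)%N,
      exists v w, [/\ Zadj z v, Zadj z w, v * w = 1 &
        lam * aut4 lam = v * (b * c ^ 2 * d ^ 3 * e ^ 3)%:R] &
      exists2 g, Zadj z g &
        lam ^+ 5 * A_ z n * A_ (z ^+ 3) n ^+ 2 * A_ (z ^+ 2) n ^+ 3
          * A_ (z ^+ 4) n ^+ 4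
        = g * (a * b * c * d)%:R * (b * c ^ 2 * d ^ 3 * e ^ 4)%:R ^+ 5].
Proof.
case: hpos => a0 b0 c0 d0 e0.
have [/= b1 hb] : exists b1, is_factor z n b b1.
  by apply: is_factor_sub hl1 _; rewrite -!mulnA dvdn_mulr.
have [/= c1 hc] : exists c1, is_factor z n c c1.
  by apply: is_factor_sub hl1 _; rewrite mulnAC -mulnA mulnAC dvdn_mull //
    dvdn_exp.
have [/= d1 hd] : exists d1, is_factor z n d d1.
  by apply: is_factor_sub hl1 _; rewrite mulnAC dvdn_mull // dvdn_exp.
have [/= e1 he] : exists e1, is_factor z n e e1.
  by apply: is_factor_sub hl1 _; rewrite dvdn_mull // dvdn_exp.
have [zb zc zd ze] : [/\ Zadj z b1, Zadj z c1, Zadj z d1 & Zadj z e1].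
  by split; apply: is_factor_Zadj; eassumption.
have nb := is_factor_cnorm hz h5 hb; have nc := is_factor_cnorm hz h5 hc.
have nd := is_factor_cnorm hz h5 hd; have ne := is_factor_cnorm hz h5 he.
have [_ b5 c5 d5 e5] := Delta_ndvd5_factors.
have X (k : nat) N l : is_factor z n N l -> is_factor z n (N ^ k) (l ^+ k).
  exact: is_factorX.
have hX1 : is_factor z n (b * c ^ 2 * d ^ 3 * e ^ 3)
    (b1 * c1 ^+ 2 * d1 ^+ 3 * e1 ^+ 3) by do !apply: is_factor_mul; auto.
have hX2 : is_factor z n (b * c * d ^ 2 * e ^ 2)
    (b1 * c1 * d1 ^+ 2 * e1 ^+ 2) by do !apply: is_factor_mul; auto.
have hX3 : is_factor z n (c * d * e) (c1 * d1 * e1).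
  by do !apply: is_factor_mul; auto.
have hXA : is_factor z n (b ^ 2 * c ^ 3 * d ^ 4 * e ^ 5)
    (b1 ^+ 2 * c1 ^+ 3 * d1 ^+ 4 * e1 ^+ 5) by do !apply: is_factor_mul; auto.
have [a1 za eA] : Zadj_dvd z (b1 ^+ 2 * c1 ^+ 3 * d1 ^+ 4 * e1 ^+ 5) (A_ z n).
  apply: (is_factor_dvd hz h5 (k := 1) hXA (Zadj_A z n) _
     (Nx := (a * b ^ 2 * c ^ 3 * d ^ 4 * e ^ 5)%N)).
  - by rewrite expr1; apply: Zadj_dvd_refl.
  - by rewrite (cnorm_A hz) hDelta.
  by rewrite -!mulnA dvdn_mull.
have na : cnorm a1 = a%:R.
  have P0 : (b ^ 2 * c ^ 3 * d ^ 4 * e ^ 5)%N%:R != 0 :> algC.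
    by rewrite pnatr_eq0 -lt0n !(expn_gt0, muln_gt0) b0 c0 d0 e0.
  apply: (mulIf P0); have hP := is_factor_cnorm hz h5 hXA.
  by rewrite -{1}hP -cnormM -eA (cnorm_A hz) hDelta -natrM !mulnA.
have [v1 [w1 [hv1 hw1 vw1 E1]]] : exists v w,
    [/\ Zadj z v, Zadj z w, v * w = 1
      & lam1 = v * (b1 * c1 ^+ 2 * d1 ^+ 3 * e1 ^+ 3)].
  have [i hi] := is_factor_dvd_exp hX1.
  apply: (is_factor_assoc hz h5 hl1 (is_factor_Zadj hX1) hi
    (is_factor_cnorm hz h5 hX1)).
  by rewrite !(expn_gt0, muln_gt0) b0 c0 d0 e0.
have p2 : (0 < b * c * d ^ 2 * e ^ 2)%N.
  by rewrite !(expn_gt0, muln_gt0) b0 c0 d0 e0.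
have p3 : (0 < c * d * e)%N by rewrite !muln_gt0 c0 d0 e0.
have [v2 [w2 [hv2 hw2 vw2 E2]]] :=
  @conj_factor_assoc aut3 3 2 _ _ _ (aut3E hz) erefl erefl p2 hl2 hX2.
have [v3 [w3 [hv3 hw3 vw3 E3]]] :=
  @conj_factor_assoc aut2 2 3 _ _ _ (aut2E hz) erefl erefl p3 hl3 hX3.
(* Each of [b], [c], [d], [e] is a norm prime to 5, hence 1 modulo 5. *)
have hM5 : (b * c ^ 2 * d ^ 3 * e ^ 4 %% 5 = 1)%N.
  have B := cnorm_mod5 hz zb nb b5; have C := cnorm_mod5 hz zc nc c5.
  have D := cnorm_mod5 hz zd nd d5; have E := cnorm_mod5 hz ze ne e5.
  have m1 x y : (x %% 5 = 1 -> y %% 5 = 1 -> x * y %% 5 = 1)%N.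
    by move=> hx hy; rewrite -modnMm hx hy.
  have e1' x k : (x %% 5 = 1 -> x ^ k %% 5 = 1)%N.
    by move=> hx; rewrite -modnXm hx exp1n.
  by do !apply: (m1); rewrite ?e1'.
split=> //.
  exists (v1 * v2 * v3 * aut4 (v1 * v2 * v3)).
  exists (w1 * w2 * w3 * aut4 (w1 * w2 * w3)); split.
  - by apply: ZadjM; [|apply: (Zadj_aut4 hz)]; zadj.
  - by apply: ZadjM; [|apply: (Zadj_aut4 hz)]; zadj.
  - transitivity ((v1 * w1) * (v2 * w2) * (v3 * w3)
      * aut4 ((v1 * w1) * (v2 * w2) * (v3 * w3))).
      by rewrite !rmorphM /=; ring.
    by rewrite vw1 vw2 vw3 !mul1r rmorph1.
  rewrite E1 E2 E3 !(natrX, natrM) -nb -nc -nd -ne /cnorm.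
  have a43 x : Zadj z x -> aut4 (aut3 x) = aut2 x.
    by apply: (aut_comp hz (aut4E hz) (aut3E hz) (aut2E hz)).
  have a42 x : Zadj z x -> aut4 (aut2 x) = aut3 x.
    by apply: (aut_comp hz (aut4E hz) (aut2E hz) (aut3E hz)).
  rewrite !(rmorphXn, rmorphM) /= !a43 // !a42 //.
  by ring.
(* What is left of the product after taking out the full norms that make up [a b c d] and [M^5]. For
   [e1] nothing is left: all four conjugates occur exactly 20 times. *)
exists ((v1 * v2 * v3) ^+ 5 * (aut3 a1 * aut2 a1 ^+ 2 * aut4 a1 ^+ 3)
  * (b1 * aut3 b1 ^+ 3 * aut4 b1 ^+ 2) * (c1 ^+ 2 * aut2 c1 ^+ 3 * aut4 c1)
  * (d1 ^+ 3 * aut3 d1 ^+ 2 * aut2 d1)).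
  have z2 x : Zadj z x -> Zadj z (aut2 x) by apply: Zadj_aut2.
  have z3 x : Zadj z x -> Zadj z (aut3 x) by apply: Zadj_aut3.
  have z4 x : Zadj z x -> Zadj z (aut4 x) by apply: Zadj_aut4.
  have [??] := (z2 _ za, z3 _ za); have ? := z4 _ za.
  have [??] := (z3 _ zb, z4 _ zb); have [??] := (z2 _ zc, z4 _ zc).
  by have [??] := (z2 _ zd, z3 _ zd); zadj.
rewrite -(aut_A n (aut2E hz)) -(aut_A n (aut3E hz)) -(aut_A n (aut4E hz)).
rewrite eA E1 E2 E3 !(natrX, natrM) -na -nb -nc -nd -ne /cnorm.
rewrite !(rmorphXn, rmorphM) /=.
by ring.
Qed.

End Factored.

Lemma alpha_arith alpha1 alpha2 alpha3 :
  normalized_factor z (b * c ^ 2 * d ^ 3 * e ^ 3) (A_ z n) alpha1 ->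
  normalized_factor z (b * c * d ^ 2 * e ^ 2) (B_ z n) alpha2 ->
  normalized_factor z (c * d * e) (C_ z n) alpha3 ->
  let alpha := alpha1 * alpha2 * alpha3 in
  [/\ (b * c ^ 2 * d ^ 3 * e ^ 4 %% 5 = 1)%N,
      Zadj_dvd z (1 - z) (alpha - 1),
      exists v w, [/\ Zadj z v, Zadj z w, v * w = 1 &
        alpha * aut4 alpha = v * (b * c ^ 2 * d ^ 3 * e ^ 3)%:R] &
      exists2 g, Zadj z g &
        alpha ^+ 5 * A_ z n * A_ (z ^+ 3) n ^+ 2 * A_ (z ^+ 2) n ^+ 3
          * A_ (z ^+ 4) n ^+ 4
        = g * (a * b * c * d)%:R * (b * c ^ 2 * d ^ 3 * e ^ 4)%:R ^+ 5].
Proof.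
move=> h1 h2 h3 alpha.
have [|lam1 [u1 [v1 [hl1 E1 hu1 [hv1 uv1] r1]]]] :=
  normalized_factorP hz (n := n) (erefl : (1 * 1 %% 5 = 1)%N) _ h1.
  by rewrite expr1.
have [|lam2 [u2 [v2 [hl2 E2 hu2 [hv2 uv2] r2]]]] :=
  normalized_factorP hz (n := n) (erefl : (3 * 2 %% 5 = 1)%N) _ h2.
  by rewrite /B_ /A_; ring: (prim5_expr5 hz).
have [|lam3 [u3 [v3 [hl3 E3 hu3 [hv3 uv3] r3]]]] :=
  normalized_factorP hz (n := n) (erefl : (2 * 3 %% 5 = 1)%N) _ h3.
  by rewrite /C_ /A_; ring: (prim5_expr5 hz).
rewrite expr1 in hl1.
have [hM [v [w [hv hw vw eN]]] [g hg eg]] := lam_arith hl1 hl2 hl3.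
have aE : alpha = (u1 * u2 * u3) * (lam1 * lam2 * lam3).
  by rewrite /alpha E1 E2 E3; ring.
have hlam : Zadj z lam1 by apply: is_factor_Zadj hl1.
have ha1 : Zadj z alpha1 by rewrite E1; zadj.
have ha2 : Zadj z alpha2.
  rewrite E2; apply: ZadjM => //; apply: (@Zadj_expr z 3).
  exact: is_factor_Zadj hl2.
split=> //.
- have -> : alpha - 1 = alpha1 * alpha2 * (alpha3 - 1)
      + (alpha1 * (alpha2 - 1) + (alpha1 - 1)) by rewrite /alpha; ring.
  by do !apply: Zadj_dvdD => //; apply: Zadj_dvd_mull => //; zadj.
- exists (u1 * u2 * u3 * aut4 (u1 * u2 * u3) * v).
  exists (v1 * v2 * v3 * aut4 (v1 * v2 * v3) * w); split.
  + by apply: ZadjM => //; apply: ZadjM; [|apply: (Zadj_aut4 hz)]; zadj.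
  + by apply: ZadjM => //; apply: ZadjM; [|apply: (Zadj_aut4 hz)]; zadj.
  + transitivity ((u1 * v1) * (u2 * v2) * (u3 * v3) * (v * w)
      * aut4 ((u1 * v1) * (u2 * v2) * (u3 * v3))).
      by rewrite !rmorphM /=; ring.
    by rewrite uv1 uv2 uv3 vw !mul1r rmorph1.
  rewrite aE rmorphM -[in RHS]mulrA -eN; move: (aut4 _) (aut4 _) => s t; ring.
exists ((u1 * u2 * u3) ^+ 5 * g); first by zadj.
rewrite aE exprMn -[in RHS]mulrA -[in RHS]mulrA [in RHS](mulrA g) -eg; ring.
Qed.

End AlphaArithmeticMain.

(** * Units of the group ring [Z[C5]] *)

Section LambdaSequence.

Lemma lambda_neq0 : lambda != 0.
Proof.
by apply/eqP => h; have := lambda_mul; rewrite h mul0r => /eqP;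
  rewrite eq_sym oner_eq0.
Qed.

Lemma lambda_bar_neq0 : lambda_bar != 0.
Proof.
by apply/eqP => h; have := lambda_mul; rewrite h mulr0 => /eqP;
  rewrite eq_sym oner_eq0.
Qed.

(** The characteristic polynomial is [(x + 1) (x^2 - 3 x + 1)], with roots -1, [lambda] and
    [lambda_bar]. *)
Lemma a_seq_rec (k : int) :
  a_seq (k + 2) = 2 * a_seq (k + 1) + 2 * a_seq k - a_seq (k - 1).
Proof.
have h5 : sqrtC 5 ^+ 2 = 5 :> algC by rewrite sqrtCK.
have rec (x : algC) : x != 0 -> x ^+ 3 = 2 * x ^+ 2 + 2 * x - 1 ->
    x ^ (k + 2) = 2 * x ^ (k + 1) + 2 * x ^ k - x ^ (k - 1).
  move=> x0 h; have e (j : nat) : x ^ (k - 1 + j%:Z) = x ^ (k - 1) * x ^+ j.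
    by rewrite expfzDr.
  have -> : k + 2 = k - 1 + 3%:Z by lia.
  have -> : k + 1 = k - 1 + 2%:Z by lia.
  have -> : x ^ k = x ^ (k - 1 + 1%:Z) by congr (_ ^ _); lia.
  by rewrite !e h; ring.
apply: (fmorph_inj (ratr : rat -> algC)).
rewrite !(rmorphB, rmorphD, rmorphM, rmorph_nat) /= !a_seqE /a_alg.
rewrite (rec _ lambda_neq0); last by rewrite /lambda; field: h5.
rewrite (rec _ lambda_bar_neq0); last by rewrite /lambda_bar; field: h5.
rewrite (rec (-1)); first by ring.
  by rewrite oppr_eq0 oner_eq0.
by ring.
Qed.

Lemma a_seq0 : a_seq 0 = 1.
Proof.
apply: (fmorph_inj (ratr : rat -> algC)).
rewrite [RHS]rmorph1 /= a_seqE /a_alg !expr0z.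
by field.
Qed.

Lemma a_seq1 : a_seq 1 = 1.
Proof.
apply: (fmorph_inj (ratr : rat -> algC)).
rewrite [RHS]rmorph1 /= a_seqE /a_alg !expr1z.
by rewrite /lambda /lambda_bar; field.
Qed.

Lemma a_seqN1 : a_seq (-1) = 1.
Proof.
have e : a_seq (-1) = 2 * a_seq 1 + 2 * a_seq 0 - a_seq 2.
  by have := a_seq_rec 0; rewrite !add0r => ->; ring.
suff h2 : a_seq 2 = 3 by rewrite e h2 a_seq0 a_seq1; ring.
have h5 : sqrtC 5 ^+ 2 = 5 :> algC by rewrite sqrtCK.
apply: (fmorph_inj (ratr : rat -> algC)).
rewrite [RHS]rmorph_nat /= a_seqE /a_alg.
by rewrite -!exprnP /lambda /lambda_bar; field: h5.
Qed.

(* [abc_seqS] and [abc_seqP]: multiplication of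
   [a_k + b_k (g + g^4) - c_k (g^2 + g^3)] by [1 - (g^2 + g^3)] and by its
   inverse [1 - (g + g^4)]. *)
Lemma abc_seqS (k : int) :
  [/\ a_seq (k + 1) = a_seq k + 2 * c_seq k, b_seq (k + 1) = c_seq k
    & c_seq (k + 1) = a_seq k + b_seq k + c_seq k].
Proof.
rewrite /b_seq /c_seq addrK -addrA -[1 + 1]/(2 : int) a_seq_rec.
by split; field.
Qed.

Lemma abc_seqP (k : int) :
  [/\ a_seq (k - 1) = a_seq k - 2 * b_seq k,
      b_seq (k - 1) = b_seq k - a_seq k + c_seq k & c_seq (k - 1) = b_seq k].
Proof.
have [hA hB hC] := abc_seqS (k - 1); rewrite subrK in hA hB hC.
by split; rewrite ?hA ?hB ?hC; ring.
Qed.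

Lemma abc_seq0 : b_seq 0 = 0 /\ c_seq 0 = 0.
Proof. by rewrite /b_seq /c_seq !add0r a_seq0 a_seq1 a_seqN1 subrr mul0r. Qed.

(** The unit [1 - (g^2 + g^3)] has augmentation -1, and this is the augmentation of its [k]-th
    power. It explains the sign of the term [(-1)^k m] in [xi_k]. *)
Lemma aug_seq (k : int) : a_seq k + 2 * b_seq k - 2 * c_seq k = (-1) ^ k.
Proof.
have [hb hc] := abc_seq0.
have step (j : int) : a_seq (j + 1) + 2 * b_seq (j + 1) - 2 * c_seq (j + 1)
    = - (a_seq j + 2 * b_seq j - 2 * c_seq j).
  by have [-> -> ->] := abc_seqS j; ring.
elim/int_rec: k => [|k IH|k IH].
- by rewrite a_seq0 hb hc; ring.
- by rewrite -addn1 PoszD step IH expfzDr // expr1z; ring.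
have := step (- k.+1%:Z); rewrite -addn1 PoszD opprD subrK IH => e.
rewrite expfzDr // -[(-1) ^ (-1)]/((-1)^-1) invrN1 -[LHS]opprK -e; ring.
Qed.

End LambdaSequence.

(** * Symmetric units by descent, and symmetry of units up to a power of [g] *)

Section GroupRingUnits.

Lemma mulz_eq1_sqr (s t : int) : s * t = 1 -> s ^+ 2 = 1.
Proof.
move=> h; have : (`|s| * `|t| == 1)%N by rewrite -abszM h.
rewrite muln_eq1 => /andP[/eqP hs _].
have : s = 1 \/ s = -1 by lia.
by case=> ->.
Qed.

(** The triple stands for [z0 + z1 (g + g^4) + z2 (g^2 + g^3)]. At [g = z] this is [p + q (z + z^4)]
    with [p = z0 - z2] and [q = z1 - z2], of norm [p^2 - p q - q^2]. Multiplying by the basic unit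
    or by its inverse, according to the sign of [p q], decreases [|p| + |q|] until [q = 0]. *)
Lemma sym_unit_descent (m : nat) (z0 z1 z2 : int) :
  (`|z0 - z2| + `|z1 - z2| < m)%N ->
  (z0 + 2 * z1 + 2 * z2) ^+ 2 = 1 ->
  (z0 - z2) ^+ 2 - (z0 - z2) * (z1 - z2) - (z1 - z2) ^+ 2 = 1 ->
  exists (k : int) (s : bool),
  [/\ z0%:~R = (-1) ^+ s * a_seq k, z1%:~R = (-1) ^+ s * b_seq k
    & z2%:~R = - ((-1) ^+ s * c_seq k)].
Proof.
elim: m z0 z1 z2 => // m IH z0 z1 z2 hm haug hN.
pose p := z0 - z2; pose q := z1 - z2.
have e0 : z0 = p + z2 by rewrite subrK.
have e1 : z1 = q + z2 by rewrite subrK.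
rewrite -/p -/q in hm hN.
have [q0|q0] := eqVneq q 0.
  have [hp z20] : (p = 1 \/ p = -1) /\ z2 = 0.
    have hp : p = 1 \/ p = -1 by move: hN; rewrite q0; nia.
    by split=> //; move: haug; rewrite e0 e1 q0; case: hp => ->; nia.
  have [hb hc] := abc_seq0.
  case: hp => hp; [exists 0, false | exists 0, true];
    by rewrite e0 e1 q0 z20 hp a_seq0 hb hc; split; ring.
have [pq|pq] := ltrP 0 (p * q).
  (* Coefficients after multiplication by [1 - (g + g^4)]. *)
  have [|||k [s [h0 h1 h2]]] := IH (z0 - 2 * z1) (z1 - z0 - z2) (- z1).
  - have -> : z0 - 2 * z1 - - z1 = p - q by rewrite /p /q; ring.
    have -> : z1 - z0 - z2 - - z1 = 2 * q - p by rewrite /p /q; ring.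
    by move: hm hN pq q0; clear; nia.
  - by rewrite -[RHS]haug; ring.
  - by rewrite -[RHS]hN /p /q; ring.
  have [hA hB hC] := abc_seqS k; exists (k + 1), s; rewrite hA hB hC.
  move: h0 h1 h2; rewrite !(intrB, intrM, intrN) => h0 h1 h2.
  by move: ((-1) ^+ s) h0 h1 h2 => t h0 h1 h2; split; lra.
(* Coefficients after multiplication by [1 - (g^2 + g^3)]. *)
have [|||k [s [h0 h1 h2]]] := IH (z0 - 2 * z2) (- z2) (z2 - z0 - z1).
- have -> : z0 - 2 * z2 - (z2 - z0 - z1) = 2 * p + q by rewrite /p /q; ring.
  have -> : - z2 - (z2 - z0 - z1) = p + q by rewrite /p /q; ring.
  by move: hm hN pq q0; clear; nia.
- by rewrite -[RHS]haug; ring.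
- by rewrite -[RHS]hN /p /q; ring.
have [hA hB hC] := abc_seqP k; exists (k - 1), s; rewrite hA hB hC.
move: h0 h1 h2; rewrite !(intrB, intrM, intrN) => h0 h1 h2.
by move: ((-1) ^+ s) h0 h1 h2 => t h0 h1 h2; split; lra.
Qed.

(** The [v_i] are the coefficients of an inverse [V], not assumed symmetric. The augmentation and
    the norm [N] are units of [Z], and [N] is the square of the augmentation modulo 5, so [N] is 1
    and not -1. *)
Lemma sym_unit (z0 z1 z2 v0 v1 v2 v3 v4 : int) :
  z0 * v0 + z1 * v4 + z2 * v3 + z2 * v2 + z1 * v1 = 1 ->
  z0 * v1 + z1 * v0 + z2 * v4 + z2 * v3 + z1 * v2 = 0 ->
  z0 * v2 + z1 * v1 + z2 * v0 + z2 * v4 + z1 * v3 = 0 ->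
  z0 * v3 + z1 * v2 + z2 * v1 + z2 * v0 + z1 * v4 = 0 ->
  z0 * v4 + z1 * v3 + z2 * v2 + z2 * v1 + z1 * v0 = 0 ->
  exists (k : int) (s : bool),
  [/\ z0%:~R = (-1) ^+ s * a_seq k, z1%:~R = (-1) ^+ s * b_seq k
    & z2%:~R = - ((-1) ^+ s * c_seq k)].
Proof.
move=> h0 h1 h2 h3 h4.
have haug : (z0 + 2 * z1 + 2 * z2) ^+ 2 = 1.
  by apply: (@mulz_eq1_sqr _ (v0 + v1 + v2 + v3 + v4)); lia.
apply: (@sym_unit_descent _ _ _ _ (ltnSn _) haug).
pose p := z0 - z2; pose q := z1 - z2; rewrite -/p -/q.
set N := p ^+ 2 - p * q - q ^+ 2.
(* Coordinates of [V + V*], which is symmetric and has product 2 with the given element. This yields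
   [N != 0] before [V] is known to be symmetric. *)
pose P := 2 * v0 - (v2 + v3); pose Q := v1 + v4 - (v2 + v3).
have hPQ : p * P + q * Q = 2 /\ p * Q + q * P - q * Q = 0.
  by split; rewrite /p /q /P /Q; lia.
have N0 : N != 0.
  apply/eqP => N0; have : N * (P ^+ 2 - P * Q - Q ^+ 2) = 4.
    case: hPQ => e1 e2; rewrite /N.
    transitivity ((p * P + q * Q) ^+ 2
      - (p * P + q * Q) * (p * Q + q * P - q * Q)
      - (p * Q + q * P - q * Q) ^+ 2); first by ring.
    by rewrite e1 e2; ring.
  by rewrite N0 mul0r.
have d1 : p * (v1 - v4) + q * (v2 - v3) = 0 by rewrite /p /q; lia.
have d2 : (p - q) * (v2 - v3) + q * (v1 - v4) = 0 by rewrite /p /q; lia.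
(* [d1] and [d2] form a linear system in [v1 - v4] and [v2 - v3] whose determinant is [N]; hence [V]
   is symmetric. *)
have v14 : v1 = v4.
  apply/eqP; rewrite -subr_eq0; apply/eqP/(mulfI N0); rewrite mulr0 /N.
  transitivity ((p - q) * (p * (v1 - v4) + q * (v2 - v3))
    - q * ((p - q) * (v2 - v3) + q * (v1 - v4))); first by ring.
  by rewrite d1 d2; ring.
have v23 : v2 = v3.
  apply/eqP; rewrite -subr_eq0; apply/eqP/(mulfI N0); rewrite mulr0 /N.
  transitivity (p * ((p - q) * (v2 - v3) + q * (v1 - v4))
    - q * (p * (v1 - v4) + q * (v2 - v3))); first by ring.
  by rewrite d1 d2; ring.
pose P' := v0 - v2; pose Q' := v1 - v2.
have hN1 : N * (P' ^+ 2 - P' * Q' - Q' ^+ 2) = 1.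
  have e1 : p * P' + q * Q' = 1 by rewrite /p /q /P' /Q'; lia.
  have e2 : p * Q' + q * P' - q * Q' = 0 by rewrite /p /q /P' /Q'; lia.
  rewrite /N; transitivity ((p * P' + q * Q') ^+ 2
      - (p * P' + q * Q') * (p * Q' + q * P' - q * Q')
      - (p * Q' + q * P' - q * Q') ^+ 2); first by ring.
  by rewrite e1 e2; ring.
have hN5 : N = 1 + 5 * (- (z1 ^+ 2 + z2 ^+ 2 + z0 * z1 + z0 * z2 + z1 * z2)).
  by rewrite -[X in X + _]haug /N /p /q; ring.
have := mulz_eq1_sqr hN1; rewrite hN5.
by move: (- (_ + _)) => T; clear; nia.
Qed.

Lemma sum5_sq1 (w0 w1 w2 w3 w4 : int) :
  w0 ^+ 2 + w1 ^+ 2 + w2 ^+ 2 + w3 ^+ 2 + w4 ^+ 2 = 1 ->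
  exists s : int, (s = 1 \/ s = -1) /\
  [\/ (w0, w1, w2, w3, w4) = (s, 0, 0, 0, 0),
      (w0, w1, w2, w3, w4) = (0, s, 0, 0, 0),
      (w0, w1, w2, w3, w4) = (0, 0, s, 0, 0) |
      (w0, w1, w2, w3, w4) = (0, 0, 0, s, 0) \/
      (w0, w1, w2, w3, w4) = (0, 0, 0, 0, s)].
Proof.
move=> h.
have b (w r : int) : 0 <= r -> w ^+ 2 + r = 1 ->
    (w = 0 /\ r = 1) \/ ((w = 1 \/ w = -1) /\ r = 0).
  move=> r0 e; have wl : w < 2 by clear -r0 e; nia.
  have wg : -2 < w by clear -r0 e; nia.
  have : w = 0 \/ w = 1 \/ w = -1 by lia.
  by case=> [|[]] wE; rewrite wE in e *; lia.
have sq (w : int) : 0 <= w ^+ 2 by rewrite sqr_ge0.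
have z2 (x y : int) : 0 <= x -> 0 <= y -> x + y = 0 -> x = 0 /\ y = 0 by lia.
have sq0 (w : int) : w ^+ 2 = 0 -> w = 0 by move/eqP; rewrite sqrf_eq0 => /eqP.
have [||[-> h1]|[hw h1]] := b w0 (w1 ^+ 2 + w2 ^+ 2 + w3 ^+ 2 + w4 ^+ 2).
- by rewrite !addr_ge0.
- by rewrite -[RHS]h; ring.
- have [||[-> h2]|[hw h2]] := b w1 (w2 ^+ 2 + w3 ^+ 2 + w4 ^+ 2).
  + by rewrite !addr_ge0.
  + by rewrite -[RHS]h1; ring.
  + have [||[-> h3]|[hw h3]] := b w2 (w3 ^+ 2 + w4 ^+ 2).
    * by rewrite !addr_ge0.
    * by rewrite -[RHS]h2; ring.
    * have [//|//|[-> h4]|[hw h4]] := b w3 (w4 ^+ 2).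
      - exists w4; split; last by constructor 4; right.
        by move: h4; clear; nia.
      by exists w3; split=> //; rewrite (sq0 _ h4); constructor 4; left.
    exists w2; split=> //; case: (z2 _ _ (sq _) (sq _) h3) => /sq0-> /sq0->.
    by constructor 3.
  exists w1; split=> //; move/z2: h2 => [||+ /sq0->]; rewrite ?addr_ge0 //.
  by case/z2 => // /sq0-> /sq0->; constructor 2.
exists w0; split=> //; move/z2: h1 => [||+ /sq0->]; rewrite ?addr_ge0 //.
case/z2 => [||+ /sq0->]; rewrite ?addr_ge0 //.
by case/z2 => // /sq0-> /sq0->; constructor 1.
Qed.

(* With [V] the inverse of [Y] and [*] the involution [g -> g^-1], the element
   [W = Y V*] satisfies [W W* = 1], so the squares of its coefficients sum to 1
   and [W] is [+- g^i]; hence [Y = g^i Y*]. *)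
Lemma unit_symmetric (y0 y1 y2 y3 y4 v0 v1 v2 v3 v4 : int) :
  y0 * v0 + y1 * v4 + y2 * v3 + y3 * v2 + y4 * v1 = 1 ->
  y0 * v1 + y1 * v0 + y2 * v4 + y3 * v3 + y4 * v2 = 0 ->
  y0 * v2 + y1 * v1 + y2 * v0 + y3 * v4 + y4 * v3 = 0 ->
  y0 * v3 + y1 * v2 + y2 * v1 + y3 * v0 + y4 * v4 = 0 ->
  y0 * v4 + y1 * v3 + y2 * v2 + y3 * v1 + y4 * v0 = 0 ->
  [\/ y1 = y4 /\ y2 = y3, y2 = y0 /\ y3 = y4, y3 = y1 /\ y4 = y0
    | y4 = y2 /\ y0 = y1 \/ y0 = y3 /\ y1 = y2].
Proof.
set e0 := y0 * v0 + _ + _ + _ + _; set e1 := y0 * v1 + _ + _ + _ + _.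
set e2 := y0 * v2 + _ + _ + _ + _; set e3 := y0 * v3 + _ + _ + _ + _.
set e4 := y0 * v4 + _ + _ + _ + _ => h0 h1 h2 h3 h4.
pose w0 := y0 * v0 + y1 * v1 + y2 * v2 + y3 * v3 + y4 * v4.
pose w1 := y0 * v4 + y1 * v0 + y2 * v1 + y3 * v2 + y4 * v3.
pose w2 := y0 * v3 + y1 * v4 + y2 * v0 + y3 * v1 + y4 * v2.
pose w3 := y0 * v2 + y1 * v3 + y2 * v4 + y3 * v0 + y4 * v1.
pose w4 := y0 * v1 + y1 * v2 + y2 * v3 + y3 * v4 + y4 * v0.
have hw : w0 ^+ 2 + w1 ^+ 2 + w2 ^+ 2 + w3 ^+ 2 + w4 ^+ 2 = 1.
  transitivity (e0 ^+ 2 + e1 ^+ 2 + e2 ^+ 2 + e3 ^+ 2 + e4 ^+ 2).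
    by rewrite /w0 /w1 /w2 /w3 /w4 /e0 /e1 /e2 /e3 /e4; ring.
  by rewrite h0 h1 h2 h3 h4; ring.
have E0 : y0 = w0 * y0 + w1 * y1 + w2 * y2 + w3 * y3 + w4 * y4.
  transitivity (y0 * e0 + y1 * e1 + y2 * e2 + y3 * e3 + y4 * e4).
    by rewrite h0 h1 h2 h3 h4; ring.
  by rewrite /w0 /w1 /w2 /w3 /w4 /e0 /e1 /e2 /e3 /e4; ring.
have E1 : y1 = w0 * y4 + w1 * y0 + w2 * y1 + w3 * y2 + w4 * y3.
  transitivity (y1 * e0 + y2 * e1 + y3 * e2 + y4 * e3 + y0 * e4).
    by rewrite h0 h1 h2 h3 h4; ring.
  by rewrite /w0 /w1 /w2 /w3 /w4 /e0 /e1 /e2 /e3 /e4; ring.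
have E2 : y2 = w0 * y3 + w1 * y4 + w2 * y0 + w3 * y1 + w4 * y2.
  transitivity (y2 * e0 + y3 * e1 + y4 * e2 + y0 * e3 + y1 * e4).
    by rewrite h0 h1 h2 h3 h4; ring.
  by rewrite /w0 /w1 /w2 /w3 /w4 /e0 /e1 /e2 /e3 /e4; ring.
have E3 : y3 = w0 * y2 + w1 * y3 + w2 * y4 + w3 * y0 + w4 * y1.
  transitivity (y3 * e0 + y4 * e1 + y0 * e2 + y1 * e3 + y2 * e4).
    by rewrite h0 h1 h2 h3 h4; ring.
  by rewrite /w0 /w1 /w2 /w3 /w4 /e0 /e1 /e2 /e3 /e4; ring.
have E4 : y4 = w0 * y1 + w1 * y2 + w2 * y3 + w3 * y4 + w4 * y0.
  transitivity (y4 * e0 + y0 * e1 + y1 * e2 + y2 * e3 + y3 * e4).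
    by rewrite h0 h1 h2 h3 h4; ring.
  by rewrite /w0 /w1 /w2 /w3 /w4 /e0 /e1 /e2 /e3 /e4; ring.
have haug : (y0 + y1 + y2 + y3 + y4) * (v0 + v1 + v2 + v3 + v4) = 1.
  transitivity (e0 + e1 + e2 + e3 + e4).
    by rewrite /e0 /e1 /e2 /e3 /e4; ring.
  by rewrite h0 h1 h2 h3 h4; ring.
(* This excludes the sign -1: [Y = - g^i Y*] would make the augmentation of [Y] vanish. *)
have nz : y0 + y1 + y2 + y3 + y4 != 0.
  by apply/eqP => h; move: haug; rewrite h mul0r.
have [s [hs cs]] := sum5_sq1 hw.
move: E0 E1 E2 E3 E4 nz hs; clear -cs.
case: cs => [||| []] [-> -> -> -> ->] E0 E1 E2 E3 E4 nz hs.
- by constructor 1; case: hs => hs; rewrite hs in E0 E1 E2 E3 E4; lia.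
- by constructor 4; left; case: hs => hs; rewrite hs in E0 E1 E2 E3 E4; lia.
- by constructor 2; case: hs => hs; rewrite hs in E0 E1 E2 E3 E4; lia.
- by constructor 4; right; case: hs => hs; rewrite hs in E0 E1 E2 E3 E4; lia.
by constructor 3; case: hs => hs; rewrite hs in E0 E1 E2 E3 E4; lia.
Qed.

End GroupRingUnits.

(** * The number field and its embedding *)

(** Evaluate at a root in [algC] of the minimal polynomial of [x]: two polynomials with equal value
    at [x] differ by a multiple of it, so the value does not depend on the polynomial chosen. The
    embedding brings [L] into the field where [z] and [alpha] live. *)
Lemma num_field_embedding (L : fieldExtType rat) (x : L) :
  <<1; x>>%VS = fullv -> exists iota : {rmorphism L -> algC}, True.
Proof.
move=> hL.
have [p hp] : exists p, minPoly 1 x = map_poly (in_alg L) p.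
  exact/polyOver1P/minPolyOver.
have [r hr] : exists r, root (map_poly (ratr : rat -> algC) p) r.
  apply/closed_rootP; rewrite size_map_poly -(size_map_poly (in_alg L)) -hp.
  by rewrite size_minPoly eqSS -lt0n adjoin_degreeE divn_gt0 ?adim_gt0 //
    dimvS // subv_adjoin.
have ex (y : L) : exists q, y == (map_poly (in_alg L) q).[x].
  have /Fadjoin1_polyP[q ->] : y \in <<1; x>>%VS by rewrite hL memvf.
  by exists q.
pose f y : algC := (map_poly ratr (xchoose (ex y))).[r].
have fE q : f (map_poly (in_alg L) q).[x] = (map_poly ratr q).[r].
  have /eqP e := xchooseP (ex (map_poly (in_alg L) q).[x]).
  apply/eqP; rewrite -subr_eq0 -hornerN -hornerD -rmorphB; set d := _ - q.
  have : minPoly 1 x %| map_poly (in_alg L) d.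
    apply: minPoly_dvdp; first by apply/polyOver1P; exists d.
    by rewrite /root rmorphB hornerD hornerN -e subrr.
  rewrite hp dvdp_map -(dvdp_map (ratr : rat -> algC)) => /dvdpP[s hs].
  by rewrite /= hs hornerM (eqP hr) mulr0.
have fB : zmod_morphism f.
  move=> y y'; have [/eqP hq /eqP hq'] := (xchooseP (ex y), xchooseP (ex y')).
  by rewrite {1}hq {1}hq' -hornerN -hornerD -rmorphB fE rmorphB hornerD hornerN.
have fM : monoid_morphism f.
  split=> [|y y'].
    by have := fE 1; rewrite !rmorph1 !hornerE.
  have [/eqP hq /eqP hq'] := (xchooseP (ex y), xchooseP (ex y')).
  by rewrite {1}hq {1}hq' -hornerM -rmorphM fE rmorphM hornerM.
pose f1 := GRing.isZmodMorphism.Build _ _ f fB.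
pose f2 := GRing.isMonoidMorphism.Build _ _ f fM.
pose iota : {rmorphism L -> algC} := HB.pack f f1 f2.
by exists iota.
Qed.

Lemma lehmer_poly_monic (n : int) :
  lehmer_poly n \is monic /\ size (lehmer_poly n) = 6%N.
Proof.
rewrite /lehmer_poly -!addrA; set p := (X in 'X^5 + X).
have hp : (size p < size ('X^5 : {poly int}))%N.
  rewrite size_polyXn ltnS /p.
  apply: (leq_trans (size_polyD _ _)); rewrite geq_max; apply/andP; split.
    by rewrite (leq_trans (size_scale_leq _ _)) ?size_polyXn.
  apply: (leq_trans (size_polyD _ _)); rewrite geq_max; apply/andP; split.
    by rewrite size_polyN (leq_trans (size_scale_leq _ _)) ?size_polyXn.
  apply: (leq_trans (size_polyD _ _)); rewrite geq_max; apply/andP; split.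
    by rewrite (leq_trans (size_scale_leq _ _)) ?size_polyXn.
  apply: (leq_trans (size_polyD _ _)); rewrite geq_max size_poly1 andbT.
  by rewrite (leq_trans (size_scale_leq _ _)) ?size_polyX.
split; last by rewrite size_polyDl // size_polyXn.
by apply/monicP; rewrite lead_coefDl // lead_coefXn.
Qed.

Section Conjugates.

Variable L : splittingFieldType rat.
Variable sigma : gal_of {:L}.
Implicit Types x y : L.

Lemma galX_add (i j : nat) x :
  (sigma ^+ (i + j))%g x = (sigma ^+ i)%g ((sigma ^+ j)%g x).
Proof. by rewrite addnC expgD galM ?memvf. Qed.

Variables (n : int) (rho : L).
Hypothesis hroot : root (map_poly intr (lehmer_poly n)) rho.
Hypothesis hL : <<1; rho>>%VS = fullv.
Hypothesis hsigma : sigma rho =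
  (n%:~R + 2 + n%:~R * rho - rho ^+ 2) / (1 + (n%:~R + 2) * rho).

Let N : L := n%:~R.
Let r (t : nat) : L := (sigma ^+ t)%g rho.

Lemma intr_num_eq0 (k : int) : (k%:~R == 0 :> L) = (k == 0).
Proof. by rewrite -(rmorph_int (in_alg L)) fmorph_eq0 intr_eq0. Qed.

(** The value is odd for every integer [n]. *)
Lemma lehmer_den_neq0 : lehmer_den N != 0.
Proof.
have -> : lehmer_den N = (n ^+ 3 + 5 * n ^+ 2 + 10 * n + 7)%:~R.
  by rewrite /lehmer_den !(intrD, intrM, rmorphXn).
rewrite intr_num_eq0; apply/eqP => h.
have [m [hm|hm]] : exists m : int, n = 2 * m \/ n = 2 * m + 1.
- by exists (n %/ 2)%Z; lia.
- have : 2 * (4 * m ^+ 3 + 10 * m ^+ 2 + 10 * m) + 7 = 0.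
    by rewrite -[RHS]h hm; ring.
  by move: (_ + _ + _) => t; lia.
have : 2 * (4 * m ^+ 3 + 16 * m ^+ 2 + 23 * m + 11) + 1 = 0.
  by rewrite -[RHS]h hm; ring.
by move: (_ + _ + _ + _) => t; lia.
Qed.

Lemma rho_root : rho ^+ 5 = - (N ^+ 2 * rho ^+ 4
  - (2 * N ^+ 3 + 6 * N ^+ 2 + 10 * N + 10) * rho ^+ 3
  + (N ^+ 4 + 5 * N ^+ 3 + 11 * N ^+ 2 + 15 * N + 5) * rho ^+ 2
  + (N ^+ 3 + 4 * N ^+ 2 + 10 * N + 10) * rho + 1).
Proof.
move: hroot; rewrite /root /lehmer_poly.
rewrite !(rmorphD, rmorphN) /= !map_polyZ !map_polyXn map_polyX rmorph1.
rewrite !(hornerD, hornerN, hornerZ, hornerXn, hornerX, hornerC).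
rewrite !(intrD, intrM, rmorphXn) /= -/N => /eqP h.
by apply/eqP; rewrite -subr_eq0 opprK -[X in _ == X]h; apply/eqP; ring.
Qed.

Lemma rho_step (t : nat) :
  (1 + (N + 2) * r t) * r t.+1 = N + 2 + N * r t - r t ^+ 2.
Proof.
have h : (1 + (N + 2) * rho) * sigma rho = N + 2 + N * rho - rho ^+ 2.
  rewrite hsigma mulrCA divff ?mulr1 //.
  exact: lehmer_step_neq0 lehmer_den_neq0 rho_root.
have := congr1 (sigma ^+ t)%g h.
rewrite !(rmorphB, rmorphD, rmorphM, rmorphXn, rmorph1, rmorph_nat) /=.
have -> : (sigma ^+ t)%g (sigma rho) = r t.+1.
  by rewrite /r -addn1 galX_add expg1.
by rewrite !rmorph_int.
Qed.

Lemma rho_step_neq0 (t : nat) : 1 + (N + 2) * r t != 0.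
Proof.
have -> : 1 + (N + 2) * r t = (sigma ^+ t)%g (1 + (N + 2) * rho).
  by rewrite !(rmorphD, rmorphM, rmorph1, rmorph_nat) /= rmorph_int.
by rewrite fmorph_eq0 (lehmer_step_neq0 lehmer_den_neq0 rho_root).
Qed.

Let D := lehmer_den N.

Lemma rho_conjE : [/\ r 1 = lehmer_num1 N rho / D, r 2 = lehmer_num2 N rho / D,
  r 3 = lehmer_num3 N rho / D, r 4 = lehmer_num4 N rho / D & r 5 = rho].
Proof.
have D0 := lehmer_den_neq0; have hx := rho_root.
have r0 : r 0 = rho by rewrite /r expg0 gal_id.
have h1 : r 1 = lehmer_num1 N rho / D.
  apply: (mulfI (rho_step_neq0 0)); rewrite rho_step r0.
  by rewrite (lehmer_step0 D0 hx).
have h2 : r 2 = lehmer_num2 N rho / D.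
  apply: (mulfI (rho_step_neq0 1)); rewrite rho_step h1.
  by rewrite (lehmer_step1 D0 hx).
have h3 : r 3 = lehmer_num3 N rho / D.
  apply: (mulfI (rho_step_neq0 2)); rewrite rho_step h2.
  by rewrite (lehmer_step2 D0 hx).
have h4 : r 4 = lehmer_num4 N rho / D.
  apply: (mulfI (rho_step_neq0 3)); rewrite rho_step h3.
  by rewrite (lehmer_step3 D0 hx).
split=> //; apply: (mulfI (rho_step_neq0 4)); rewrite rho_step h4.
by rewrite (lehmer_step4 D0 hx).
Qed.

Lemma gal_order5 x : (sigma ^+ 5)%g x = x.
Proof.
have [_ _ _ _ h5] := rho_conjE.
have /Fadjoin1_polyP[q ->] : x \in <<1; rho>>%VS by rewrite hL memvf.
rewrite -horner_map /= -/(r 5) h5 -map_poly_comp; congr (_.[_]).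
by apply: eq_map_poly => c /=; rewrite linearZ /= rmorph1.
Qed.

Lemma rho_relations :
  [/\ r 0 + r 1 + r 2 + r 3 + r 4 = - N ^+ 2,
      r 0 ^+ 2 + 2 * r 1 * r 4 + 2 * r 2 * r 3
        = - (N + 1) ^+ 2 * r 0 + (2 * N + 4) * r 1 + (N - 1) * r 2 - r 3
          - (N + 1) * r 4,
      r 0 * r 1 + r 1 * r 2 + r 2 * r 3 + r 3 * r 4 + r 4 * r 0
        = - (N ^+ 3 + 3 * N ^+ 2 + 5 * N + 5) &
      r 0 * r 2 + r 1 * r 3 + r 2 * r 4 + r 3 * r 0 + r 4 * r 1
        = - (N ^+ 3 + 3 * N ^+ 2 + 5 * N + 5)].
Proof.
have D0 := lehmer_den_neq0; have hx := rho_root.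
have r0 : r 0 = rho by rewrite /r expg0 gal_id.
have [-> -> -> -> _] := rho_conjE; rewrite r0; split.
- exact: lehmer_trace D0.
- exact: lehmer_square D0 hx.
- exact: lehmer_prod1 D0 hx.
exact: lehmer_prod2 D0 hx.
Qed.

Lemma rho_integral : integralOver (intr : int -> L) rho.
Proof. by exists (lehmer_poly n) => //; case: (lehmer_poly_monic n). Qed.

(** An upper bound is all that is required: the five conjugates of [xi_0] turn out to be independent
    and are then a basis. *)
Lemma num_field_dim_le5 : (\dim {:L} <= 5)%N.
Proof.
have [mp sp] := lehmer_poly_monic n.
have sq : size (map_poly (intr : int -> L) (lehmer_poly n)) = 6%N.
  by rewrite size_map_poly_id0 // (monicP mp) intr_num_eq0.
rewrite -hL dim_Fadjoin dimv1 muln1 -ltnS -size_minPoly -sq.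
apply: dvdp_leq; first by rewrite -size_poly_eq0 sq.
apply: minPoly_dvdp => //; apply/polyOverP => i; rewrite coef_map /=.
by rewrite -(rmorph_int (in_alg L)) rpredZ ?mem1v.
Qed.

End Conjugates.

(** * Integers of [Q(z)] *)

Section IntegersOfQz.

Variable z : algC.
Hypothesis hz : 5.-primitive_root z.

Definition ctrace (x : algC) : algC := x + aut2 x + aut3 x + aut4 x.

Lemma ctrace_Aint x : x \in Aint -> ctrace x \in Aint.
Proof. by move=> hx; rewrite /ctrace !rpredD ?Aint_aut. Qed.

(* [z^(5 - j)] is [z^-j], so these traces isolate the coordinates. *)
Lemma ctrace_coord (x0 x1 x2 x3 : rat) :
  let x : algC :=
    ratr x0 + ratr x1 * z + ratr x2 * z ^+ 2 + ratr x3 * z ^+ 3 in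
  [/\ ctrace (x * z ^+ 5) - ctrace (x * z) = ratr (5 * x0),
      ctrace (x * z ^+ 4) - ctrace (x * z) = ratr (5 * x1),
      ctrace (x * z ^+ 3) - ctrace (x * z) = ratr (5 * x2) &
      ctrace (x * z ^+ 2) - ctrace (x * z) = ratr (5 * x3)].
Proof.
move=> x; rewrite /ctrace.
have e (u : {rmorphism algC -> algC}) (j k : nat) : u z = z ^+ j ->
    u (x * z ^+ k) = (ratr x0 + ratr x1 * z ^+ j + ratr x2 * (z ^+ j) ^+ 2
       + ratr x3 * (z ^+ j) ^+ 3) * (z ^+ j) ^+ k.
  move=> uz; rewrite rmorphM rmorphXn /= uz; congr (_ * _).
  by apply: aut_coord; rewrite ?fmorph_rat.
rewrite -[x * z]/(x * z ^+ 1) !(e _ _ _ (aut2E hz)) !(e _ _ _ (aut3E hz)).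
rewrite !(e _ _ _ (aut4E hz)) /x !rmorphM !rmorph_nat.
by split; ring: (prim5_expr4 hz).
Qed.

Lemma Qz_coord_eq0 (x0 x1 x2 x3 : rat) :
  ratr x0 + ratr x1 * z + ratr x2 * z ^+ 2 + ratr x3 * z ^+ 3 = 0 ->
  [/\ x0 = 0, x1 = 0, x2 = 0 & x3 = 0].
Proof.
move=> h; have := ctrace_coord x0 x1 x2 x3; rewrite /= h !mul0r /ctrace.
rewrite !rmorph0 !addr0 subrr.
have inj (k : rat) : 0 = ratr (5 * k) :> algC -> k = 0.
  by move=> /eqP; rewrite eq_sym fmorph_eq0 mulf_eq0 => /orP[//|/eqP].
by case=> /inj-> /inj-> /inj-> /inj->.
Qed.

Lemma cnorm_1z : cnorm (1 - z) = 5.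
Proof.
rewrite /cnorm !(rmorphB, rmorph1) /= (aut2E hz) (aut3E hz) (aut4E hz).
by ring: (prim5_expr4 hz).
Qed.

Lemma cnorm_int (w : int) : cnorm w%:~R = (w ^+ 4)%:~R.
Proof. by rewrite /cnorm !rmorph_int rmorphXn; ring. Qed.

Lemma Zadj_dvd_1z_int (w : int) : Zadj_dvd z (1 - z) w%:~R -> (5 %| w)%Z.
Proof.
move=> [q hq e]; have [K hK] := Zadj_cnorm hz hq.
have : (5 %| w ^+ 4)%Z.
  apply/dvdzP; exists K%:Z; apply/eqP.
  by rewrite -(eqr_int algC) -cnorm_int e cnormM cnorm_1z hK intrM.
by rewrite !dvdzE abszX Euclid_dvdX // andbT.
Qed.

(** If [w] is the residue of [x], then [w] is [1 - z] times an algebraic integer of norm [w^4 / 5].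
    This norm is rational and integral, so 5 divides [w], and [1 - z] divides [w] inside [Z[z]]. *)
Lemma Zadj_div_1z x y : Zadj z x -> y \in Aint -> x = (1 - z) * y -> Zadj z y.
Proof.
move=> hx hy e; have [w [[q hq eq] _]] := Zadj_residue hz hx.
have [f hf ef] := five_dvd hz.
have hq' := Zadj_Aint hz hq.
have z1 : 1 - z != 0 by rewrite subr_eq0 eq_sym prim5_neq1.
have ew : w%:~R = (1 - z) * (y - q).
  by rewrite mulrBr -e [(1 - z) * q]mulrC -eq; ring.
have hc : cnorm (y - q) = (w ^+ 4)%:~R / 5.
  by rewrite -cnorm_int ew cnormM cnorm_1z mulrC mulKf // pnatr_eq0.
have : cnorm (y - q) \in Num.int.
  apply: Cint_rat_Aint; first by rewrite hc rpredM ?rpredV ?rpred_int ?rpred_nat.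
  by rewrite /cnorm !rpredM ?Aint_aut ?rpredB.
case/intrP => k hk; have : (5 %| w ^+ 4)%Z.
  apply/dvdzP; exists k; apply/eqP; rewrite -(eqr_int algC) intrM -hk hc.
  by rewrite divfK // pnatr_eq0.
rewrite dvdzE abszX Euclid_dvdX // andbT => h5.
have /dvdzP[w' wE] : (5 %| w)%Z by [].
have -> : y = q + w'%:~R * f.
  apply: (mulfI z1); rewrite -e mulrDr [(1 - z) * q]mulrC -eq wE intrM.
  by rewrite [5%:~R]ef; ring.
by zadj.
Qed.

(** Traces put [5 x] in [Z[z]]. As 5 is associate to [(1 - z)^4], [Zadj_div_1z] removes the
    denominator in four steps. So [Z[z]] is integrally closed. *)
Lemma Aint_Zadj (x0 x1 x2 x3 : rat) :
  let x := ratr x0 + ratr x1 * z + ratr x2 * z ^+ 2 + ratr x3 * z ^+ 3 in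
  x \in Aint -> Zadj z x.
Proof.
move=> x hx; have zA := Aint_prim_root hz.
have rint (k : rat) (i : nat) :
    ctrace (x * z ^+ i) - ctrace (x * z) = ratr (5 * k) ->
    exists j : int, 5 * ratr k = j%:~R :> algC.
  move=> e; have : ratr (5 * k) \in @Num.int algC.
    apply: Cint_rat_Aint; first exact: Crat_rat.
    by rewrite -e rpredB // ctrace_Aint // rpredM // rpredX.
  by rewrite rmorphM rmorph_nat => /intrP.
have [h0 h1 h2 h3] := ctrace_coord x0 x1 x2 x3.
have [k0 e0] := rint _ _ h0; have [k1 e1] := rint _ _ h1.
have [k2 e2] := rint _ _ h2; have [k3 e3] := rint _ _ h3.
have h5 : Zadj z (5 * x).
  apply/(ZadjP _ hz); exists k0, k1, k2, k3; rewrite -e0 -e1 -e2 -e3 /x; ring.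
have z1A : 1 - z \in Aint by rewrite rpredB.
have h4 : Zadj z ((1 - z) * ((1 - z) * ((1 - z) * ((1 - z) * x)))).
  have -> : (1 - z) * ((1 - z) * ((1 - z) * ((1 - z) * x)))
      = (- z + z ^+ 2 - z ^+ 3) * (5 * x) by ring: (prim5_expr4 hz).
  by apply: ZadjM => //; zadj.
by do 4!(apply: (Zadj_div_1z _ _ erefl); rewrite ?rpredM //).
Qed.

(** * Nilpotents modulo a square-free integer prime to 5 *)

Definition nil_mod (e x : algC) : Prop := exists m : nat, x ^+ m / e \in Aint.

Lemma nil_modD e x y : x \in Aint -> y \in Aint -> nil_mod e x -> nil_mod e y ->
  nil_mod e (x + y).
Proof.
move=> hx hy [a ha] [b hb]; exists (a + b)%N.
rewrite exprDn mulr_suml rpred_sum // => i _.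
rewrite -mulr_natl -mulrA; apply: rpredM; first exact: (Aint_int _%:Z).
have [hi|hi] := leqP b i.
  have -> : x ^+ (a + b - i) * y ^+ i / e
      = x ^+ (a + b - i) * y ^+ (i - b) * (y ^+ b / e).
    have -> : y ^+ i = y ^+ (i - b) * y ^+ b by rewrite -exprD subnK.
    by ring.
  exact: rpredM (rpredM (rpredX _ hx) (rpredX _ hy)) hb.
have hi' : (a <= a + b - i)%N by rewrite -addnBA ?leq_addr // ltnW.
have -> : x ^+ (a + b - i) * y ^+ i / e
    = x ^+ (a + b - i - a) * y ^+ i * (x ^+ a / e).
  have {1}-> : x ^+ (a + b - i) = x ^+ (a + b - i - a) * x ^+ a.
    by rewrite -exprD subnK.
  by ring.
exact: rpredM (rpredM (rpredX _ hx) (rpredX _ hy)) ha.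
Qed.

(* [Y] is nilpotent modulo [p], hence so are the traces of the [Y z^i], which
   are rational integers determining the coordinates of [5 Y]. *)
Lemma Zadj_pdiv (p : nat) Y : prime p -> p != 5%N -> Zadj z Y ->
  Y ^+ 5 / p%:R \in Aint -> Zadj z (Y / p%:R).
Proof.
move=> pp p5 hY hd; have zA := Aint_prim_root hz; have YA := Zadj_Aint hz hY.
have p0 : p%:R != 0 :> algC by rewrite pnatr_eq0 -lt0n prime_gt0.
have [y0 [y1 [y2 [y3 YE]]]] := (ZadjP Y hz).1 hY.
have nil1 i : nil_mod p%:R (Y * z ^+ i).
  exists 5%N; rewrite exprMn -mulrA mulrCA rpredM // !rpredX //.
have nilu (u : {rmorphism algC -> algC}) i : nil_mod p%:R (u (Y * z ^+ i)).
  have [m hm] := nil1 i; exists m.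
  by rewrite -rmorphXn -(rmorph_nat u) -fmorphV -rmorphM Aint_aut.
have iA i : Y * z ^+ i \in Aint by rewrite rpredM // rpredX.
have nilt i : nil_mod p%:R (ctrace (Y * z ^+ i)).
  by rewrite /ctrace; do !apply: nil_modD; rewrite ?rpredD ?Aint_aut.
have niln x : nil_mod p%:R x -> nil_mod p%:R (- x).
  move=> [m hm]; exists m; rewrite exprNn -mulrA rpredM //.
  by rewrite rpredX // rpredN rpred1.
have dvd (k : int) i : ctrace (Y * z ^+ i) - ctrace (Y * z) = ratr (5 * k%:~R) ->
    exists j : int, k = j * p%:Z.
  move=> e; have [m] : nil_mod p%:R (ratr (5 * k%:~R)).
    rewrite -e; apply: nil_modD; rewrite ?rpredN ?ctrace_Aint //.
      by rewrite -[z]expr1.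
    by apply: niln; rewrite -[X in _ * X]expr1.
  rewrite rmorphM rmorph_nat rmorph_int => hm.
  have : ((5 * k%:~R) ^+ m / p%:R : algC) \in Num.int.
    by apply: Cint_rat_Aint hm; rewrite !(rpredM, rpredX, rpredV, rpred_nat, rpred_int).
  case/intrP => j hj; have : (p %| (5 * k) ^+ m)%Z.
    apply/dvdzP; exists j; apply/eqP; rewrite -(eqr_int algC) intrM rmorphXn /=.
    by rewrite intrM -hj divfK.
  rewrite dvdzE abszX Euclid_dvdX // abszM Euclid_dvdM // => /andP[/orP[]].
    by rewrite dvdn_prime2 // (negPf p5).
  by move=> h _; apply/dvdzP.
have := ctrace_coord y0%:~R y1%:~R y2%:~R y3%:~R.
rewrite !ratr_int -YE => -[h0 h1 h2 h3].
have [k0 e0] := dvd _ _ h0; have [k1 e1] := dvd _ _ h1.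
have [k2 e2] := dvd _ _ h2; have [k3 e3] := dvd _ _ h3.
apply/(ZadjP _ hz); exists k0, k1, k2, k3; apply: (mulIf p0).
by rewrite divfK // YE e0 e1 e2 e3 !intrM -!pmulrn; ring.
Qed.

Lemma squarefree_dvd m k : squarefree m -> (k %| m)%N -> squarefree k.
Proof. by move=> h hk q hq; apply: h; apply: dvdn_trans hk. Qed.

(** With [f = g p], where [p] is a prime not dividing [g] because [f] is square-free, [Y / f] is a
    Bezout combination of [Y / p] and [Y / g]. *)
Lemma Zadj_sqf_div (f : nat) Y : (0 < f)%N -> squarefree f -> ~~ (5 %| f)%N ->
  Zadj z Y -> Y ^+ 5 / f%:R \in Aint -> Zadj z (Y / f%:R).
Proof.
elim/ltn_ind: f Y => f IH Y f0 sf f5 hY hd.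
have [f1|f1] := eqVneq f 1%N; first by rewrite f1 divr1.
have pp : prime (pdiv f) by rewrite pdiv_prime // ltn_neqAle eq_sym f1.
have [g fE] := dvdnP (pdiv_dvd f); set p := pdiv f in pp fE.
have p0 : p%:R != 0 :> algC by rewrite pnatr_eq0 -lt0n prime_gt0.
have g0 : (0 < g)%N by move: f0; rewrite fE muln_gt0 => /andP[].
have g0' : g%:R != 0 :> algC by rewrite pnatr_eq0 -lt0n.
have p5 : p != 5%N by apply: contra f5 => /eqP <-; rewrite pdiv_dvd.
have gp : coprime g p.
  rewrite coprime_sym prime_coprime //; apply/negP => /dvdnP[h gE].
  have /sf p1 : (p ^ 2 %| f)%N by rewrite fE gE -mulnA mulnn dvdn_mull.
  by move: pp; rewrite p1.
have h1 : Zadj z (Y / p%:R).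
  apply: Zadj_pdiv => //.
  have -> : Y ^+ 5 / p%:R = g%:R * (Y ^+ 5 / f%:R).
    by rewrite fE natrM; field; rewrite g0' p0.
  by rewrite rpredM // Aint_Cnat // natr_nat.
have h2 : Zadj z (Y / g%:R).
  apply: IH => //.
  - by rewrite fE ltn_Pmulr // prime_gt1.
  - by apply: squarefree_dvd sf _; rewrite fE dvdn_mulr.
  - by apply: contra f5; rewrite fE; apply: dvdn_mulr.
  have -> : Y ^+ 5 / g%:R = p%:R * (Y ^+ 5 / f%:R).
    by rewrite fE natrM; field; rewrite g0' p0.
  by rewrite rpredM // Aint_Cnat // natr_nat.
have /coprimezP[[u v] /= uv] : coprimez g p by rewrite /coprimez /gcdz /=.
have -> : Y / f%:R = u%:~R * (Y / p%:R) + v%:~R * (Y / g%:R).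
  rewrite fE natrM; transitivity ((u * g + v * p)%:~R * (Y / (g%:R * p%:R))).
    by rewrite uv mul1r.
  by rewrite intrD !intrM -!pmulrn; field; rewrite g0' p0.
by zadj.
Qed.

Lemma Aint_integral x : x \in Aint <-> integralOver (intr : int -> algC) x.
Proof.
split=> [|[p mp rp]]; last first.
  apply: root_monic_Aint rp _ _; first exact: monic_map.
  by apply/polyOverP => i; rewrite coef_map; apply: intr_int.
move=> hx; have /floorpP[p hp] : minCpoly x \is a polyOver Num.int by [].
exists p; last by rewrite -hp root_minCpoly.
have := minCpoly_monic x; rewrite hp !monicE lead_coef_map_inj //.
  by rewrite -[X in _ == X]/(1%:~R) eqr_int.
exact: intr_inj.
Qed.

Lemma Aint_expr x (k : nat) : (0 < k)%N -> x ^+ k \in Aint -> x \in Aint.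
Proof.
move=> k0 hx; apply/Aint_integral.
apply: (@integral_root_monic _ _ _ _ ('X^k - (x ^+ k)%:P)).
- exact: monicXnsubC.
- by rewrite /root !hornerE subrr.
apply/integral_poly => i; rewrite coefB coefXn coefC; apply/Aint_integral.
apply: rpredB; first by case: eqP.
by case: eqP => // _; exact: Aint0.
Qed.

End IntegersOfQz.

(** * Lagrange resolvents *)

Section Resolvents.

Variable L : splittingFieldType rat.
Variable sigma : gal_of {:L}.
Hypothesis hs5 : forall x : L, (sigma ^+ 5)%g x = x.
Variable iota : {rmorphism L -> algC}.
Implicit Types (x y : L) (z : algC).

Definition cj (t : nat) x : algC := iota ((sigma ^+ t)%g x).

Lemma cj_gal (i j : nat) x : cj i ((sigma ^+ j)%g x) = cj (i + j) x.
Proof. by rewrite /cj galX_add. Qed.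

Lemma cj_mod (i : nat) x : cj (i + 5) x = cj i x.
Proof. by rewrite /cj galX_add hs5. Qed.

Lemma cj0 x : cj 0 x = iota x.
Proof. by rewrite /cj expg0 gal_id. Qed.

Lemma cjD t x y : cj t (x + y) = cj t x + cj t y.
Proof. by rewrite /cj !rmorphD. Qed.

Lemma cjZ t (a : rat) x : cj t (a *: x) = ratr a * cj t x.
Proof. by rewrite /cj linearZ /= rmorphZ_num. Qed.

Lemma cj_rat t (a : rat) : cj t a%:A = ratr a.
Proof. by rewrite cjZ /cj !rmorph1 mulr1. Qed.

(** The powers [z^4], [z^3], [z^2], [z] stand for [z^-1] to [z^-4]; with this convention [sigma]
    multiplies the resolvent by [z]. *)
Definition res z x : algC :=
  cj 0 x + z ^+ 4 * cj 1 x + z ^+ 3 * cj 2 x + z ^+ 2 * cj 3 x + z * cj 4 x.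

Definition ctr x : algC := cj 0 x + cj 1 x + cj 2 x + cj 3 x + cj 4 x.

Lemma resD z x y : res z (x + y) = res z x + res z y.
Proof. by rewrite /res !cjD; ring. Qed.

Lemma resZ z (a : rat) x : res z (a *: x) = ratr a * res z x.
Proof. by rewrite /res !cjZ; ring. Qed.

Lemma res_rat z (a : rat) : 5.-primitive_root z -> res z a%:A = 0.
Proof. by move=> hz; rewrite /res !cj_rat; ring: (prim5_expr4 hz). Qed.

Lemma res_gal z (t : nat) x : z ^+ 5 = 1 ->
  res z ((sigma ^+ t)%g x) = z ^+ t * res z x.
Proof.
move=> hz; elim: t x => [|t IH] x; first by rewrite expg0 gal_id expr0 mul1r.
rewrite -addn1 galX_add IH exprD -mulrA; congr (_ * _).
by rewrite /res !cj_gal -[(4 + 1)%N]/(0 + 5)%N cj_mod; ring: hz.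
Qed.

Lemma sum_res z x : 5.-primitive_root z ->
  5 * iota x = ctr x + res z x + res (z ^+ 2) x + res (z ^+ 3) x
               + res (z ^+ 4) x.
Proof.
by move=> hz; rewrite -cj0 /res /ctr; ring: (prim5_expr4 hz).
Qed.

Definition gact (w : 'I_5 -> rat) x : L := \sum_(t < 5) w t *: (sigma ^+ t)%g x.

Lemma res_gact z w x : z ^+ 5 = 1 ->
  res z (gact w x) = (\sum_(t < 5) ratr (w t) * z ^+ t) * res z x.
Proof.
move=> hz; rewrite /gact !big_ord_recl !big_ord0 !addr0 !resD !resZ.
by rewrite !res_gal //; ring.
Qed.

Lemma ctr_gact w x : ctr (gact w x) = ratr (\sum_(t < 5) w t) * ctr x.
Proof.
rewrite /gact !big_ord_recl !big_ord0 !addr0 /ctr !cjD !cjZ !cj_gal /=.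
rewrite /bump /= !(addSn, add0n).
have m5 : cj 5 x = cj 0 x := cj_mod 0 x.
have m6 : cj 6 x = cj 1 x := cj_mod 1 x.
have m7 : cj 7 x = cj 2 x := cj_mod 2 x.
have m8 : cj 8 x = cj 3 x := cj_mod 3 x.
by rewrite m5 m6 m7 m8 !rmorphD /=; ring.
Qed.

Lemma iota_gact w x : iota (gact w x)
  = ratr (w ord0) * cj 0 x + ratr (w (lift ord0 ord0)) * cj 1 x
    + ratr (w (lift ord0 (lift ord0 ord0))) * cj 2 x
    + ratr (w (lift ord0 (lift ord0 (lift ord0 ord0)))) * cj 3 x
    + ratr (w (lift ord0 (lift ord0 (lift ord0 (lift ord0 ord0))))) * cj 4 x.
Proof.
rewrite -cj0 /gact !big_ord_recl big_ord0 addr0 !cjD !cjZ !cj_gal /=.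
by rewrite /bump /= !(addSn, add0n) !addrA.
Qed.

Variables (n : int) (rho : L).
Let N : algC := n%:~R.
Let r (t : nat) : algC := cj t rho.
Let R (t : nat) : L := (sigma ^+ t)%g rho.
Hypothesis hrel : [/\ R 0 + R 1 + R 2 + R 3 + R 4 = - n%:~R ^+ 2,
  R 0 ^+ 2 + 2 * R 1 * R 4 + 2 * R 2 * R 3
    = - (n%:~R + 1) ^+ 2 * R 0 + (2 * n%:~R + 4) * R 1 + (n%:~R - 1) * R 2
      - R 3 - (n%:~R + 1) * R 4,
  R 0 * R 1 + R 1 * R 2 + R 2 * R 3 + R 3 * R 4 + R 4 * R 0
    = - (n%:~R ^+ 3 + 3 * n%:~R ^+ 2 + 5 * n%:~R + 5) &
  R 0 * R 2 + R 1 * R 3 + R 2 * R 4 + R 3 * R 0 + R 4 * R 1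
    = - (n%:~R ^+ 3 + 3 * n%:~R ^+ 2 + 5 * n%:~R + 5)].

Lemma cj_square (t : nat) :
  r t ^+ 2 + 2 * r (t + 1) * r (t + 4) + 2 * r (t + 2) * r (t + 3)
  = - (N + 1) ^+ 2 * r t + (2 * N + 4) * r (t + 1) + (N - 1) * r (t + 2)
    - r (t + 3) - (N + 1) * r (t + 4).
Proof.
have [_ h _ _] := hrel; have := congr1 (cj t) h; rewrite /cj.
rewrite !(rmorphB, rmorphN, rmorphD, rmorphM, rmorphXn, rmorph1, rmorph_nat) /=.
by rewrite -!galX_add !rmorph_int addn0.
Qed.

Lemma cj_trace : r 0 + r 1 + r 2 + r 3 + r 4 = - N ^+ 2.
Proof.
have [h _ _ _] := hrel; have := congr1 iota h.
by rewrite !(rmorphD, rmorphN, rmorphXn) /= rmorph_int.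
Qed.

Lemma cj_prod :
  r 0 * r 1 + r 1 * r 2 + r 2 * r 3 + r 3 * r 4 + r 4 * r 0
    = - (N ^+ 3 + 3 * N ^+ 2 + 5 * N + 5) /\
  r 0 * r 2 + r 1 * r 3 + r 2 * r 4 + r 3 * r 0 + r 4 * r 1
    = - (N ^+ 3 + 3 * N ^+ 2 + 5 * N + 5).
Proof.
have [_ _ h1 h2] := hrel; have := congr1 iota h1; have := congr1 iota h2.
rewrite !(rmorphD, rmorphN, rmorphM, rmorphXn, rmorph_nat) /= !rmorph_int.
by move=> e2 e1; split.
Qed.

Lemma res_rho_sqr z : 5.-primitive_root z ->
  res z rho ^+ 2 = - (A_ (z ^+ 2) n * A_ (z ^+ 4) n * res (z ^+ 2) rho).
Proof.
move=> hz.
have m5 : r 5 = r 0 := cj_mod 0 rho.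
have m6 : r 6 = r 1 := cj_mod 1 rho.
have m7 : r 7 = r 2 := cj_mod 2 rho.
have m8 : r 8 = r 3 := cj_mod 3 rho.
have h0 := cj_square 0; have h1 := cj_square 1; have h2 := cj_square 2.
have h3 := cj_square 3; have h4 := cj_square 4.
rewrite !(add0n, add1n, add2n, addSn) in h0 h1 h2 h3 h4.
rewrite ?m5 ?m6 ?m7 ?m8 in h0 h1 h2 h3 h4.
(* The brackets are the conjugates of the left side of [lehmer_square]. The one moved by [sigma^t]
   carries [z^(-2t)], which is why a multiple of [tau(z^2)] appears. *)
have -> : res z rho ^+ 2
  = (r 0 ^+ 2 + 2 * r 1 * r 4 + 2 * r 2 * r 3)
    + z ^+ 3 * (r 1 ^+ 2 + 2 * r 2 * r 0 + 2 * r 3 * r 4)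
    + z * (r 2 ^+ 2 + 2 * r 3 * r 1 + 2 * r 4 * r 0)
    + z ^+ 4 * (r 3 ^+ 2 + 2 * r 4 * r 2 + 2 * r 0 * r 1)
    + z ^+ 2 * (r 4 ^+ 2 + 2 * r 0 * r 3 + 2 * r 1 * r 2).
  rewrite /res -/(r 0) -/(r 1) -/(r 2) -/(r 3) -/(r 4).
  by ring: (prim5_expr5 hz).
rewrite h0 h1 h2 h3 h4 /res -/(r 0) -/(r 1) -/(r 2) -/(r 3) -/(r 4) /A_ -/N.
by ring: (prim5_expr4 hz).
Qed.

Lemma res_rho_mul z : 5.-primitive_root z ->
  res z rho * res (z ^+ 4) rho = (Delta n)%:~R.
Proof.
move=> hz; have ht := cj_trace; have [h1 h2] := cj_prod.
transitivity ((r 0 + r 1 + r 2 + r 3 + r 4) ^+ 2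
  + (z + z ^+ 4 - 2)
    * (r 0 * r 1 + r 1 * r 2 + r 2 * r 3 + r 3 * r 4 + r 4 * r 0)
  + (z ^+ 2 + z ^+ 3 - 2)
    * (r 0 * r 2 + r 1 * r 3 + r 2 * r 4 + r 3 * r 0 + r 4 * r 1)).
  rewrite /res -/(r 0) -/(r 1) -/(r 2) -/(r 3) -/(r 4).
  by ring: (prim5_expr5 hz).
rewrite ht h1 h2 /Delta !(intrD, intrM, rmorphXn) /= -/N.
by ring: (prim5_expr4 hz).
Qed.

Lemma Delta_prod z : 5.-primitive_root z ->
  (Delta n)%:~R = A_ z n * A_ (z ^+ 2) n * A_ (z ^+ 3) n * A_ (z ^+ 4) n.
Proof.
move=> hz; rewrite -(cnorm_A hz) /cnorm (aut_A n (aut2E hz)).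
by rewrite (aut_A n (aut3E hz)) (aut_A n (aut4E hz)).
Qed.

(** In [tau^5 = (tau^2)^2 tau], squaring twice leads from [z] to [z^4], and [tau(z) tau(z^4)] is
    [Delta_n], the product of the conjugates of [A_n]. *)
Lemma res_rho_expr5 z : 5.-primitive_root z ->
  res z rho ^+ 5 = - (A_ z n * A_ (z ^+ 3) n ^+ 2 * A_ (z ^+ 2) n ^+ 3
                      * A_ (z ^+ 4) n ^+ 4).
Proof.
move=> hz; have hz2 := prim5_exp hz (isT : coprime 2 5).
have h1 := res_rho_sqr hz; have h2 := res_rho_sqr hz2; have h4 := res_rho_mul hz.
have h8 : z ^+ 8 = z ^+ 3 by rewrite -(prim_expr_mod hz).
rewrite -!exprM /= h8 in h2; rewrite (Delta_prod hz) in h4.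
transitivity ((res z rho ^+ 2) ^+ 2 * res z rho); first by ring.
rewrite h1 sqrrN exprMn h2.
transitivity (- ((A_ (z ^+ 2) n * A_ (z ^+ 4) n) ^+ 2 * A_ (z ^+ 4) n
  * A_ (z ^+ 3) n * (res z rho * res (z ^+ 4) rho))); first by ring.
by rewrite h4; ring.
Qed.

End Resolvents.

Lemma integral_embedding (L : fieldExtType rat) (iota : {rmorphism L -> algC})
    (x : L) : integralOver (intr : int -> L) x <-> iota x \in Aint.
Proof.
have e (p : {poly int}) :
    map_poly (intr : int -> algC) p = map_poly iota (map_poly intr p).
  by rewrite -map_poly_comp; apply: eq_map_poly => k /=; rewrite rmorph_int.
split=> [[p mp rp]|/Aint_integral[p mp rp]].
  by apply/Aint_integral; exists p; rewrite // e fmorph_root.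
by exists p => //; rewrite e fmorph_root in rp.
Qed.

Lemma gal_integral (L : splittingFieldType rat) (sigma : gal_of {:L})
    (t : nat) (x : L) : ring_of_integers x ->
  ring_of_integers ((sigma ^+ t)%g x).
Proof.
move=> [p mp rp]; exists p => //; rewrite -(fmorph_root (sigma ^+ t)%g) in rp.
rewrite -map_poly_comp in rp.
suff e0 : map_poly ((sigma ^+ t)%g \o intr) p = map_poly (intr : int -> L) p.
  by rewrite e0 in rp.
by apply: eq_map_poly => k /=; rewrite rmorph_int.
Qed.

(** Euler's criterion at the prime 5, checked on residues. *)
Lemma legendre5 (n : int) : ~~ (5 %| n)%Z ->
  (legendre n 5 = 1 \/ legendre n 5 = -1) /\ (5 %| legendre n 5 - n ^+ 2)%Z.
Proof.
move=> hn; rewrite /legendre (negPf hn).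
have hmod (y : nat) : (y%:Z ^+ 2 == n %[mod 5])%Z
    = (y%:Z ^+ 2 == (n %% 5)%Z %[mod 5])%Z.
  by rewrite modz_mod.
have sq : (n ^+ 2 = (n %% 5)%Z ^+ 2 %[mod 5])%Z by rewrite modzXm.
have [r hr] := modz5_ord n.
have hE : [exists y : 'I_5, ((y : nat)%:Z ^+ 2 == n %[mod 5])%Z]
    = [exists y : 'I_5, ((y : nat)%:Z ^+ 2 == r%:Z %[mod 5])%Z].
  by apply: eq_existsb => y; rewrite hmod hr.
rewrite hE -eqz_mod_dvd eq_sym sq hr.
have nr : nat_of_ord r != 0%N.
  by apply: contra hn => /eqP r0; apply/dvdz_mod0P; rewrite hr r0.
have yes (y : 'I_5) : ((y : nat)%:Z ^+ 2 == r%:Z %[mod 5])%Z ->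
    [exists y : 'I_5, ((y : nat)%:Z ^+ 2 == r%:Z %[mod 5])%Z].
  by move=> h; apply/existsP; exists y.
case: r nr {hr hE} yes => -[|[|[|[|[|//]]]]] lt nr yes //.
- by rewrite (yes (inord 1)) ?inordK //; split; [left|].
- rewrite ifF; first by split; [right|].
  by apply/existsP => -[[[|[|[|[|[|//]]]]] ?]].
- rewrite ifF; first by split; [right|].
  by apply/existsP => -[[[|[|[|[|[|//]]]]] ?]].
by rewrite (yes (inord 2)) ?inordK //; split; [left|].
Qed.

Lemma squarefree_mul (x y : nat) : squarefree x -> squarefree y -> coprime x y ->
  squarefree (x * y).
Proof.
move=> hx hy cxy q hq; apply/eqP/negPn/negP => q1.
have x0 : (0 < x)%N.
  by rewrite lt0n; apply/eqP => x0; have := hx 2%N; rewrite x0 dvdn0 => /(_ isT).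
have y0 : (0 < y)%N.
  by rewrite lt0n; apply/eqP => y0; have := hy 2%N; rewrite y0 dvdn0 => /(_ isT).
have [q0|q0] := posnP q.
  by move: hq; rewrite q0 dvd0n muln_eq0 !eqn0Ngt x0 y0.
have pp : prime (pdiv q) by rewrite pdiv_prime // ltn_neqAle eq_sym q1.
have : (pdiv q ^ 2 %| x * y)%N.
  by apply: dvdn_trans hq; rewrite dvdn_exp2r // pdiv_dvd.
set p := pdiv q in pp * => hp.
have [px|px] := boolP (p %| x)%N.
  have py : coprime (p ^ 2) y.
    by rewrite coprimeXl //; apply: coprime_dvdl px cxy.
  move: hp; rewrite Gauss_dvdl // => /hx p1.
  by move: pp; rewrite p1.
have py : coprime (p ^ 2) x by rewrite coprimeXl // prime_coprime.
move: hp; rewrite Gauss_dvdr // => /hy p1.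
by move: pp; rewrite p1.
Qed.

(** * The generator [xi_0] *)

Section NormalIntegralBasis.

Variables (n : int) (L : splittingFieldType rat) (rho : L) (sigma : gal_of {:L}).
Variables (a b c d e : nat) (z : algC) (alpha1 alpha2 alpha3 : algC).
Variables (beta0 beta1 beta2 beta3 : int).
Hypothesis hn : ~~ (5 %| n)%Z.
Hypothesis hroot : root (map_poly intr (lehmer_poly n)) rho.
Hypothesis hL : <<1; rho>>%VS = fullv.
Hypothesis hsigma : sigma rho =
  (n%:~R + 2 + n%:~R * rho - rho ^+ 2) / (1 + (n%:~R + 2) * rho).
Hypothesis hpos :
  [/\ (0 < a)%N, (0 < b)%N, (0 < c)%N, (0 < d)%N & (0 < e)%N].
Hypothesis hDelta : Delta n = (a * b ^ 2 * c ^ 3 * d ^ 4 * e ^ 5)%N%:Z.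
Hypothesis hsqf : [/\ squarefree a, squarefree b, squarefree c & squarefree d].
Hypothesis hcop : [&& coprime a b, coprime a c, coprime a d,
  coprime b c, coprime b d & coprime c d].
Hypothesis hz : 5.-primitive_root z.
Hypothesis halpha1 :
  normalized_factor z (b * c ^ 2 * d ^ 3 * e ^ 3) (A_ z n) alpha1.
Hypothesis halpha2 :
  normalized_factor z (b * c * d ^ 2 * e ^ 2) (B_ z n) alpha2.
Hypothesis halpha3 : normalized_factor z (c * d * e) (C_ z n) alpha3.
Hypothesis hbeta : alpha1 * alpha2 * alpha3 =
  beta0%:~R + beta1%:~R * z + beta2%:~R * z ^+ 2 + beta3%:~R * z ^+ 3.

Variable iota : {rmorphism L -> algC}.

Local Notation M := (b * c ^ 2 * d ^ 3 * e ^ 4)%N.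
Local Notation alpha := (alpha1 * alpha2 * alpha3).
Local Notation XI := (xi sigma rho n b c d e beta0 beta1 beta2 beta3).
Local Notation cj := (cj sigma iota).
Local Notation res := (res sigma iota).
Local Notation ctr := (ctr sigma iota).
Local Notation leg := (legendre n 5).

Let h5 : ~~ (5 %| Delta n)%Z := Delta_ndvd5 hn.
Let hs5 x : (sigma ^+ 5)%g x = x := gal_order5 hroot hL hsigma x.
Let hrel := rho_relations hroot hsigma.
Let M0 : M%:R != 0 :> algC.
Proof.
case: hpos => _ b0 c0 d0 e0.
by rewrite pnatr_eq0 -lt0n !(expn_gt0, muln_gt0) b0 c0 d0 e0.
Qed.

Lemma theta0 : [/\ theta beta0 beta1 beta2 beta3 0 ord0 = beta0%:~R,
  theta beta0 beta1 beta2 beta3 0 (lift ord0 ord0) = beta1%:~R,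
  theta beta0 beta1 beta2 beta3 0 (lift ord0 (lift ord0 ord0)) = beta2%:~R,
  theta beta0 beta1 beta2 beta3 0 (lift ord0 (lift ord0 (lift ord0 ord0)))
    = beta3%:~R &
  theta beta0 beta1 beta2 beta3 0
    (lift ord0 (lift ord0 (lift ord0 (lift ord0 ord0)))) = 0].
Proof.
have [hb hc] := abc_seq0.
by rewrite /theta /= hb hc a_seq0; split; ring.
Qed.

Lemma res_xi0 y : 5.-primitive_root y ->
  res y (XI 0) = (beta0%:~R + beta1%:~R * y + beta2%:~R * y ^+ 2
                  + beta3%:~R * y ^+ 3) * res y rho / M%:R.
Proof.
move=> hy; rewrite /xi -/(gact sigma _ rho) resZ resD -scaleNr res_rat // addr0.
rewrite (res_gact hs5) ?prim5_expr5 // !big_ord_recl big_ord0 /=.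
have [-> -> -> -> ->] := theta0; rewrite !ratr_int rmorph0.
rewrite fmorphV rmorph_nat /bump /=.
by move: M0; move: (M%:R : algC) => m m0; field.
Qed.

Lemma ratr_m_const : ratr (m_const n b c d e beta0 beta1 beta2 beta3)
  = (leg%:~R * M%:R - n%:~R ^+ 2
     * (beta0%:~R + beta1%:~R + beta2%:~R + beta3%:~R)) / 5 :> algC.
Proof.
rewrite /m_const rmorphM fmorphV rmorph_nat [LHS]mulrC; congr (_ / _).
by rewrite /= ratr_int intrB !intrM !intrD.
Qed.

(** The constant [m] is made for this: [rho] has trace [- n^2], and subtracting [5 m] leaves only
    the Legendre symbol times [M]. *)
Lemma ctr_xi0 : ctr (XI 0) = - leg%:~R.
Proof.
have ctrZ (k : rat) x : ctr (k *: x) = ratr k * ctr x.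
  by rewrite /ctr !cjZ; ring.
have ctrD x y : ctr (x + y) = ctr x + ctr y.
  by rewrite /ctr !cjD; ring.
have ctr1 (k : rat) : ctr k%:A = 5 * ratr k.
  by rewrite /ctr !cj_rat; ring.
rewrite /xi -/(gact sigma _ rho) ctrZ ctrD -scaleNr ctr1 (ctr_gact hs5).
rewrite !big_ord_recl big_ord0; have [-> -> -> -> ->] := theta0.
have -> : ctr rho = - n%:~R ^+ 2 by rewrite -(cj_trace iota hrel).
rewrite expr0z mul1r rmorphN /= ratr_m_const fmorphV rmorph_nat addr0 -!intrD.
rewrite ratr_int !intrD.
by move: M0; move: (M%:R : algC) => m m0; field.
Qed.

Let arith := alpha_arith hz h5 hpos hDelta halpha1 halpha2 halpha3.

(** Modulo 5 both [M] and the sum of the [beta_j] are 1, the latter because [alpha] is 1 modulo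
    [1 - z]. *)
Lemma m_const_int :
  exists k : int, m_const n b c d e beta0 beta1 beta2 beta3 = k%:~R.
Proof.
have [hM hd _ _] := arith.
pose S := beta0 + beta1 + beta2 + beta3.
have hS : (5 %| S - 1)%Z.
  apply: (Zadj_dvd_1z_int hz).
  have -> : (S - 1)%:~R = (alpha - 1) + (beta1%:~R + beta2%:~R * (1 + z)
      + beta3%:~R * (1 + z + z ^+ 2)) * (1 - z).
    by rewrite hbeta /S intrB !intrD; ring.
  apply: Zadj_dvdD hd _; apply: Zadj_dvd_mull (Zadj_dvd_refl _ _).
  by zadj.
have [_ hl] := legendre5 hn.
have hM1 : (5 %| M%:Z - 1)%Z by rewrite -eqz_mod_dvd modz_nat hM.
have /dvdzP[k hk] : (5 %| leg * M%:Z - n ^+ 2 * S)%Z.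
  have -> : leg * M%:Z - n ^+ 2 * S
    = (leg - n ^+ 2) * M%:Z + n ^+ 2 * (M%:Z - 1) - n ^+ 2 * (S - 1) by ring.
  by rewrite rpredB ?rpredD ?(dvdz_mulr _ hl) ?dvdz_mull.
by exists k; rewrite /m_const hk intrM mulrC mulfK.
Qed.

Lemma res_xi0_expr5 (g : algC) (u : {rmorphism algC -> algC}) (j : nat) :
  alpha ^+ 5 * A_ z n * A_ (z ^+ 3) n ^+ 2 * A_ (z ^+ 2) n ^+ 3
    * A_ (z ^+ 4) n ^+ 4 = g * (a * b * c * d)%:R * M%:R ^+ 5 ->
  u z = z ^+ j -> coprime j 5 ->
  res (z ^+ j) (XI 0) ^+ 5 = - (u g * (a * b * c * d)%:R).
Proof.
move=> eg uz hj; have hzj := prim5_exp hz hj.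
have uA i : u (A_ (z ^+ i) n) = A_ ((z ^+ j) ^+ i) n.
  rewrite /A_ !(rmorphD, rmorphM, rmorphXn) /= uz rmorph_int.
  by rewrite rmorph1.
have := congr1 u eg; rewrite -{1}[z]expr1.
rewrite !(rmorphXn u, rmorphM u) !uA !(rmorph_nat u) expr1 => ug.
have ua : u alpha = beta0%:~R + beta1%:~R * z ^+ j
    + beta2%:~R * (z ^+ j) ^+ 2 + beta3%:~R * (z ^+ j) ^+ 3.
  by rewrite hbeta; apply: aut_icoord.
rewrite res_xi0 // -ua !exprMn (res_rho_expr5 hs5 iota hrel hzj) exprVn.
apply: (mulIf (expf_neq0 5 M0)); rewrite divfK ?expf_neq0 // mulNr -ug.
by rewrite !(rmorphM u); ring.
Qed.

Lemma res_xi0_mul (v : algC) :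
  alpha * aut4 alpha = v * (b * c ^ 2 * d ^ 3 * e ^ 3)%:R ->
  res z (XI 0) * res (z ^+ 4) (XI 0) = v * (a * b * c * d)%:R.
Proof.
move=> ev; have hz4 := prim5_exp hz (isT : coprime 4 5).
rewrite !res_xi0 // -hbeta -(aut_icoord _ _ _ _ (aut4E hz)) -hbeta.
transitivity (alpha * aut4 alpha * (res z rho * res (z ^+ 4) rho) / M%:R ^+ 2).
  by move: M0 (aut4 _); move: (M%:R : algC) => m m0 t; field.
rewrite ev (res_rho_mul iota hrel hz) hDelta; apply: (mulIf (expf_neq0 2 M0)).
rewrite divfK ?expf_neq0 // -[_%:Z%:~R]/(_%:R) !(natrX, natrM); ring.
Qed.

Lemma cj_Aint (t : nat) (x : L) : ring_of_integers x -> cj t x \in Aint.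
Proof. by move=> hx; apply/integral_embedding; apply: gal_integral. Qed.

Lemma res_Aint (j : nat) (x : L) : ring_of_integers x ->
  res (z ^+ j) x \in Aint.
Proof.
move=> hx; have zA := rpredX j (Aint_prim_root hz).
by do ![apply: rpredD => //]; do ?[apply: rpredM => //]; do ?[apply: rpredX => //];
  apply: cj_Aint.
Qed.

Lemma xi0_Aint : iota (XI 0) \in Aint.
Proof.
have [hM _ _ [g hg eg]] := arith.
have gA : g \in Aint := Zadj_Aint hz hg.
have nA (k : nat) : k%:R \in Aint by rewrite Aint_Cnat // natr_nat.
have resA (u : {rmorphism algC -> algC}) (j : nat) :
    u z = z ^+ j -> coprime j 5 -> res (z ^+ j) (XI 0) \in Aint.
  move=> uz hj; apply: (@Aint_expr _ 5) => //.
  by rewrite (res_xi0_expr5 eg uz hj) rpredN rpredM ?Aint_aut.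
have h5xi : 5 * iota (XI 0) \in Aint.
  rewrite (sum_res sigma iota (XI 0) hz) ctr_xi0.
  have r1 : res z (XI 0) \in Aint.
    by rewrite -[z]expr1; apply: (resA idfun).
  have r2 := resA _ _ (aut2E hz) erefl; have r3 := resA _ _ (aut3E hz) erefl.
  have r4 := resA _ _ (aut4E hz) erefl.
  by do 4![apply: rpredD => //]; rewrite rpredN Aint_int.
have hMxi : M%:R * iota (XI 0) \in Aint.
  have [k hk] := m_const_int.
  rewrite /xi rmorphZ_num fmorphV rmorph_nat mulVKf // rmorphB rmorph_sum /=.
  rewrite rpredB ?rpred_sum // => [t _|].
    rewrite rmorphZ_num rpredM //; last exact: cj_Aint (rho_integral hroot).
    have [t0 t1 t2 t3 t4] := theta0.
    have : exists j : int, theta beta0 beta1 beta2 beta3 0 t = j%:~R.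
      case: t => -[|[|[|[|[|//]]]]] ht.
      - by exists beta0; rewrite -t0; congr (theta _ _ _ _ _ _); apply: val_inj.
      - by exists beta1; rewrite -t1; congr (theta _ _ _ _ _ _); apply: val_inj.
      - by exists beta2; rewrite -t2; congr (theta _ _ _ _ _ _); apply: val_inj.
      - by exists beta3; rewrite -t3; congr (theta _ _ _ _ _ _); apply: val_inj.
      by exists 0; rewrite -[RHS]t4; congr (theta _ _ _ _ _ _); apply: val_inj.
    by case=> j ->; rewrite ratr_int Aint_int.
  by rewrite expr0z mul1r hk rmorphZ_num rmorph1 mulr1 ratr_int Aint_int.
(* Here [M = 5 (M %/ 5) + 1] is used. *)
have -> : iota (XI 0)
    = M%:R * iota (XI 0) - (M %/ 5)%:R * (5 * iota (XI 0)).
  have {1}-> : M = (M %/ 5 * 5 + 1)%N by rewrite {1}(divn_eq M 5) hM.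
  by rewrite natrD natrM; ring.
by rewrite rpredB // rpredM.
Qed.

Let f0 : (a * b * c * d)%:R != 0 :> algC.
Proof.
case: hpos => a0 b0 c0 d0 _.
by rewrite pnatr_eq0 -lt0n !muln_gt0 a0 b0 c0 d0.
Qed.

Lemma res_xi0_neq0 : res z (XI 0) != 0.
Proof.
have [_ _ [v [w [_ _ vw ev]]] _] := arith.
apply/eqP => h; have := res_xi0_mul ev; rewrite h mul0r => /esym/eqP.
rewrite mulf_eq0 (negPf f0) orbF => /eqP v0.
by move/eqP: vw; rewrite v0 mul0r eq_sym oner_eq0.
Qed.

Lemma leg_neq0 : leg%:~R != 0 :> algC.
Proof. by rewrite intr_eq0; have [[->|->] _] := legendre5 hn. Qed.

Lemma sum5_reduce (w : 'I_5 -> rat) :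
  let w4 := w (lift ord0 (lift ord0 (lift ord0 (lift ord0 ord0)))) in
  \sum_(t < 5) ratr (w t) * z ^+ t
  = ratr (w ord0 - w4) + ratr (w (lift ord0 ord0) - w4) * z
    + ratr (w (lift ord0 (lift ord0 ord0)) - w4) * z ^+ 2
    + ratr (w (lift ord0 (lift ord0 (lift ord0 ord0))) - w4) * z ^+ 3.
Proof.
move=> w4; rewrite !big_ord_recl big_ord0 /bump /= -/w4 !rmorphB /=.
by ring: (prim5_expr4 hz).
Qed.

Lemma ord5_forall (P : 'I_5 -> Prop) :
  P ord0 -> P (lift ord0 ord0) -> P (lift ord0 (lift ord0 ord0)) ->
  P (lift ord0 (lift ord0 (lift ord0 ord0))) ->
  P (lift ord0 (lift ord0 (lift ord0 (lift ord0 ord0)))) -> forall i, P i.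
Proof.
move=> h0 h1 h2 h3 h4 [[|[|[|[|[|//]]]]] hi].
- by rewrite (_ : Ordinal hi = ord0) //; apply: val_inj.
- by rewrite (_ : Ordinal hi = lift ord0 ord0) //; apply: val_inj.
- by rewrite (_ : Ordinal hi = lift ord0 (lift ord0 ord0)) //; apply: val_inj.
- rewrite (_ : Ordinal hi = lift ord0 (lift ord0 (lift ord0 ord0))) //.
  exact: val_inj.
rewrite (_ : Ordinal hi = lift ord0 (lift ord0 (lift ord0 (lift ord0 ord0)))) //.
exact: val_inj.
Qed.

(** The nonzero resolvent at one [z] determines the coefficients up to a common constant, since
    [1, z, z^2, z^3] are independent over the rationals; the nonzero trace of [xi_0] then kills the
    constant. *)
Lemma gact_xi0_inj w : gact sigma w (XI 0) = 0 -> forall i, w i = 0.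
Proof.
move=> h.
have := res_gact hs5 iota w (XI 0) (prim5_expr5 hz); rewrite h.
have -> : res z 0 = 0 by rewrite -(scale0r (0 : L)) resZ rmorph0 mul0r.
move/esym/eqP; rewrite mulf_eq0 (negPf res_xi0_neq0) orbF sum5_reduce.
move=> /eqP/(Qz_coord_eq0 hz)[/subr0_eq h0 /subr0_eq h1 /subr0_eq h2 /subr0_eq h3].
have := ctr_gact hs5 iota w (XI 0); rewrite h ctr_xi0.
have -> : ctr 0 = 0 by rewrite /ctr /cj !rmorph0 !addr0.
move/esym/eqP; rewrite mulf_eq0 oppr_eq0 (negPf leg_neq0) orbF fmorph_eq0.
rewrite !big_ord_recl big_ord0 h0 h1 h2 h3; set w4 := w _ => /eqP hw.
have w40 : w4 = 0 by lra.
by apply: ord5_forall; rewrite ?h0 ?h1 ?h2 ?h3 -/w4.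
Qed.

Lemma gact_xi0_span (x : L) : exists w, x = gact sigma w (XI 0).
Proof.
pose X := [tuple (sigma ^+ (i : 'I_5))%g (XI 0) | i < 5].
have XE (i : 'I_5) : X`_i = (sigma ^+ i)%g (XI 0).
  by rewrite -tnth_nth tnth_mktuple.
have fX : free X.
  apply/freeP => k hk; apply: gact_xi0_inj; rewrite -[RHS]hk /gact.
  by apply: eq_bigr => i _; rewrite XE.
have bX : basis_of fullv X.
  by rewrite basisEfree fX subvf size_tuple (num_field_dim_le5 hroot hL).
exists (fun i => coord X i x); rewrite {1}(coord_basis bX (memvf x)).
by apply: eq_bigr => i _; rewrite XE.
Qed.

Lemma xi0_integral : ring_of_integers (XI 0).
Proof. exact/(integral_embedding iota)/xi0_Aint. Qed.

Lemma xi0_lattice (x : L) : ring_of_integers x ->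
  exists k : 'I_5 -> int, x = \sum_(i < 5) (sigma ^+ i)%g (XI 0) *~ k i.
Proof.
move=> hx; have [w xE] := gact_xi0_span x.
have [_ _ [v [v' [hv hv' vv' ev]]] [g hg eg]] := arith.
have zA := Aint_prim_root hz.
set w4 := w (lift ord0 (lift ord0 (lift ord0 (lift ord0 ord0)))).
pose X := \sum_(t < 5) ratr (w t) * z ^+ t : algC.
pose f := (a * b * c * d)%N.
have y1 := res_gact hs5 iota w (XI 0) (prim5_expr5 hz).
rewrite -xE -/X in y1.
have yA : res z x \in Aint by rewrite -[z]expr1; apply: res_Aint.
have cA : res (z ^+ 4) (XI 0) \in Aint := res_Aint 4 xi0_integral.
(* Multiplying by the resolvent of [xi_0] at [z^4] replaces a division by the one at [z], as their
   product is a unit times [f]. The same factor contributes the [f] that divides the fifth power of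
   [X f]. *)
have YE : X * f%:R = res z x * res (z ^+ 4) (XI 0) * v'.
  rewrite y1 -[X * _ * _]mulrA (res_xi0_mul ev) -/f.
  by transitivity (X * f%:R * (v * v')); [rewrite vv' mulr1 | ring].
have fA : f%:R \in Aint by rewrite Aint_Cnat // natr_nat.
have v'A := Zadj_Aint hz hv'; have gA := Zadj_Aint hz hg.
have YA : X * f%:R \in Aint by rewrite YE !rpredM.
have YZ : Zadj z (X * f%:R).
  have XfE : X * f%:R = ratr ((w ord0 - w4) * f%:R)
      + ratr ((w (lift ord0 ord0) - w4) * f%:R) * z
      + ratr ((w (lift ord0 (lift ord0 ord0)) - w4) * f%:R) * z ^+ 2
      + ratr ((w (lift ord0 (lift ord0 (lift ord0 ord0))) - w4) * f%:R)
        * z ^+ 3.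
    by rewrite /X sum5_reduce -/w4 !(rmorphM (ratr : rat -> algC)) /= !ratr_nat;
       ring.
  by rewrite XfE; apply: Aint_Zadj => //; rewrite -XfE.
have [k0 [k1 [k2 [k3 XZ]]]] : exists x0 x1 x2 x3 : int,
    X = x0%:~R + x1%:~R * z + x2%:~R * z ^+ 2 + x3%:~R * z ^+ 3.
  apply/(ZadjP _ hz); rewrite -[X](mulfK f0).
  have [a5 b5 c5 d5 _] := Delta_ndvd5_factors h5 hDelta.
  have [a0 b0 c0 d0 _] := hpos; have [sa sb sc sd] := hsqf.
  case/and5P: hcop => ab ac ad bc /andP[bd cd].
  apply: (Zadj_sqf_div hz) => //.
  - by rewrite !muln_gt0 a0 b0 c0 d0.
  - apply: squarefree_mul => //; last by rewrite !coprimeMl ad bd cd.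
    apply: squarefree_mul => //; last by rewrite coprimeMl ac bc.
    exact: squarefree_mul.
  - by rewrite !Euclid_dvdM // !negb_or a5 b5 c5 d5.
  rewrite -/f YE !exprMn (res_xi0_expr5 eg (aut4E hz)) // -/f.
  have -> : res z x ^+ 5 * - (aut4 g * f%:R) * v' ^+ 5 / f%:R
      = - (res z x ^+ 5 * aut4 g * v' ^+ 5).
    by move: f0 (aut4 g); rewrite -/f; move: (f%:R : algC) => F F0 G; field.
  by rewrite rpredN !rpredM ?rpredX ?Aint_aut.
have : ratr (w ord0 - w4 - k0%:~R) + ratr (w (lift ord0 ord0) - w4 - k1%:~R) * z
    + ratr (w (lift ord0 (lift ord0 ord0)) - w4 - k2%:~R) * z ^+ 2
    + ratr (w (lift ord0 (lift ord0 (lift ord0 ord0))) - w4 - k3%:~R) * z ^+ 3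
    = 0 :> algC.
  have := sum5_reduce w; rewrite -/w4 -/X XZ => e0.
  rewrite !(rmorphB (ratr : rat -> algC) _ _%:~R) /= !ratr_int.
  rewrite -(subrr (k0%:~R + k1%:~R * z + k2%:~R * z ^+ 2 + k3%:~R * z ^+ 3)).
  by rewrite [X in _ = X - _]e0; ring.
case/(Qz_coord_eq0 hz) => /subr0_eq h0 /subr0_eq h1 /subr0_eq h2 /subr0_eq h3.
(* The differences [w_i - w4] are now known to be integers, so [w4] times the trace of [xi_0] is
   integral; that trace is [- leg], a sign. *)
have [j w4E] : exists j : int, w4 = j%:~R.
  have : ratr w4 * leg%:~R \in Aint.
    have -> : ratr w4 * leg%:~R = k0%:~R * cj 0 (XI 0) + k1%:~R * cj 1 (XI 0)
        + k2%:~R * cj 2 (XI 0) + k3%:~R * cj 3 (XI 0) - cj 0 x.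
      rewrite [cj 0 x]cj0 xE iota_gact -/w4.
      have hh (u k : rat) : u - w4 = k -> u = k + w4 by move=> <-; ring.
      rewrite (hh _ _ h0) (hh _ _ h1) (hh _ _ h2) (hh _ _ h3) !rmorphD /=.
      rewrite !ratr_int.
      have -> : leg%:~R = - ctr (XI 0) :> algC by rewrite ctr_xi0 opprK.
      by rewrite /ctr; ring.
    by do ![apply: rpredD]; rewrite ?rpredN; do ?[apply: rpredM]; rewrite ?Aint_int //;
       apply: cj_Aint => //; apply: xi0_integral.
  move=> hA; have : ratr w4 * leg%:~R \in @Num.int algC.
    by apply: Cint_rat_Aint hA; rewrite rpredM ?Crat_rat ?rpred_int.
  case/intrP => j hj; exists (j * leg); apply: (fmorph_inj (ratr : rat -> algC)).
  rewrite /= ratr_int intrM -hj -mulrA -intrM.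
  by have [[->|->] _] := legendre5 hn; rewrite ?mulr1 // mulr1.
have hk (u : rat) (k : int) : u - w4 = k%:~R -> exists l : int, u = l%:~R.
  by move=> e0; exists (k + j); rewrite intrD -e0 -w4E subrK.
have : forall i, exists l : int, w i = l%:~R.
  apply: ord5_forall; [exact: hk h0|exact: hk h1|exact: hk h2|exact: hk h3|].
  by exists j.
case/fin_all_exists => l wl; exists l; rewrite {1}xE /gact.
by apply: eq_bigr => i _; rewrite wl scaler_int.
Qed.

Lemma xi0_normal_integral_generator : normal_integral_generator sigma (XI 0).
Proof.
split=> [i|x /xi0_lattice //|w hw].
  exact: gal_integral xi0_integral.
have : gact sigma (fun i => (w i)%:~R) (XI 0) = 0.
  by rewrite -[RHS]hw; apply: eq_bigr => i _; rewrite scaler_int.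
by move/gact_xi0_inj => h i; apply/eqP; rewrite -(intr_eq0 rat) h.
Qed.

(** [xi_k] is [xi_0] multiplied by the [k]-th power of the basic unit: the [theta_t(k)] are the
    coefficients of its product with the [beta_j], and the constants agree by [aug_seq]. *)
Lemma cj_xi (k : int) (t : nat) :
  cj t (XI k) = ratr (a_seq k) * cj t (XI 0)
    + ratr (b_seq k) * (cj (t + 1) (XI 0) + cj (t + 4) (XI 0))
    - ratr (c_seq k) * (cj (t + 2) (XI 0) + cj (t + 3) (XI 0)).
Proof.
have m5 (i : nat) : cj (t + i.+4.+1) rho = cj (t + i) rho.
  by rewrite -(cj_mod hs5 iota (t + i)) -addnA [(i + 5)%N]addnC.
pose mc := m_const n b c d e beta0 beta1 beta2 beta3.
pose m : algC := ratr mc.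
have cj0E (i : nat) : cj (t + i) (XI 0) = (beta0%:~R * cj (t + i) rho
    + beta1%:~R * cj (t + i.+1) rho + beta2%:~R * cj (t + i.+2) rho
    + beta3%:~R * cj (t + i.+3) rho - m) / M%:R.
  rewrite /xi -/mc -/(gact sigma _ rho) cjZ cjD -scaleNr cj_rat expr0z mul1r.
  rewrite [ratr (- mc)]rmorphN -/m /gact !big_ord_recl big_ord0 addr0.
  rewrite !cjD !cjZ !cj_gal /=.
  have [-> -> -> -> ->] := theta0; rewrite /bump /= !(addSn, add0n) rmorph0.
  rewrite !ratr_int fmorphV rmorph_nat addn0 !addnS !addn0.
  by move: M0; move: (M%:R : algC) => q q0; field.
have -> : cj t (XI 0) = cj (t + 0) (XI 0) by rewrite addn0.
rewrite !cj0E !m5 -[cj (t + 0) rho]/(cj (t + 0) rho).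
rewrite /m => {cj0E}; have Minv : ratr (M%:R^-1 : rat) = M%:R^-1 :> algC.
  by rewrite fmorphV rmorph_nat.
rewrite /xi -/mc -/(gact sigma _ rho) cjZ cjD -scaleNr cj_rat Minv.
clearbody mc; rewrite -aug_seq /gact !big_ord_recl big_ord0 addr0.
rewrite !cjD !cjZ !cj_gal /= /bump /= !(addSn, add0n).
rewrite /theta /=; move: (a_seq k) (b_seq k) (c_seq k) => A B C.
pose rr := (ratr : rat -> algC).
rewrite !(rmorphB rr, rmorphD rr, rmorphN rr, rmorphM rr, rmorph1 rr) /= !ratr_int.
rewrite !addn0.
by move: M0; move: (M%:R : algC) => q q0; field.
Qed.

End NormalIntegralBasis.

(** * Action of the group ring *)

Section GroupRingAction.

Variable L : splittingFieldType rat.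
Variable sigma : gal_of {:L}.
Hypothesis hs5 : forall x : L, (sigma ^+ 5)%g x = x.
Variable iota : {rmorphism L -> algC}.
Implicit Types (x y : L).

Local Notation cj := (cj sigma iota).

Definition zact (w : 'I_5 -> int) x : L := \sum_(i < 5) (sigma ^+ i)%g x *~ w i.

Lemma zact0 w : zact w 0 = 0.
Proof. by rewrite /zact big1 // => i _; rewrite rmorph0 mul0rz. Qed.

Definition int5 (y0 y1 y2 y3 y4 : int) (i : 'I_5) : int :=
  [:: y0; y1; y2; y3; y4]`_i.

Lemma cj_zact w (t : nat) x : cj t (zact w x)
  = (w ord0)%:~R * cj t x + (w (lift ord0 ord0))%:~R * cj (t + 1) x
    + (w (lift ord0 (lift ord0 ord0)))%:~R * cj (t + 2) x
    + (w (lift ord0 (lift ord0 (lift ord0 ord0))))%:~R * cj (t + 3) x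
    + (w (lift ord0 (lift ord0 (lift ord0 (lift ord0 ord0)))))%:~R
      * cj (t + 4) x.
Proof.
have cjMz (k : int) y : cj t (y *~ k) = k%:~R * cj t y.
  by rewrite /cj !raddfMz /= mulrzl.
rewrite /zact !big_ord_recl big_ord0 addr0 !cjD !cjMz !cj_gal /=.
by rewrite /bump /= !(addSn, add0n) addn0 !addrA.
Qed.

Let cj_modE x : [/\ cj 5 x = cj 0 x, cj 6 x = cj 1 x, cj 7 x = cj 2 x
  & cj 8 x = cj 3 x].
Proof.
by split; [exact: (cj_mod hs5 iota 0)|exact: (cj_mod hs5 iota 1)
  |exact: (cj_mod hs5 iota 2)|exact: (cj_mod hs5 iota 3)].
Qed.

Lemma zactC w v x : zact w (zact v x) = zact v (zact w x).
Proof.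
apply: (fmorph_inj iota); rewrite -!(cj0 sigma) !cj_zact !(addSn, add0n).
by have [-> -> -> ->] := cj_modE x; ring.
Qed.

Definition conv5 (w v : 'I_5 -> int) : 'I_5 -> int :=
  let w0 := w ord0 in let w1 := w (lift ord0 ord0) in
  let w2 := w (lift ord0 (lift ord0 ord0)) in
  let w3 := w (lift ord0 (lift ord0 (lift ord0 ord0))) in
  let w4 := w (lift ord0 (lift ord0 (lift ord0 (lift ord0 ord0)))) in
  let v0 := v ord0 in let v1 := v (lift ord0 ord0) in
  let v2 := v (lift ord0 (lift ord0 ord0)) in
  let v3 := v (lift ord0 (lift ord0 (lift ord0 ord0))) in
  let v4 := v (lift ord0 (lift ord0 (lift ord0 (lift ord0 ord0)))) in
  int5 (w0 * v0 + w1 * v4 + w2 * v3 + w3 * v2 + w4 * v1)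
       (w0 * v1 + w1 * v0 + w2 * v4 + w3 * v3 + w4 * v2)
       (w0 * v2 + w1 * v1 + w2 * v0 + w3 * v4 + w4 * v3)
       (w0 * v3 + w1 * v2 + w2 * v1 + w3 * v0 + w4 * v4)
       (w0 * v4 + w1 * v3 + w2 * v2 + w3 * v1 + w4 * v0).

Lemma zact_conv w v x : zact w (zact v x) = zact (conv5 w v) x.
Proof.
apply: (fmorph_inj iota); rewrite -!(cj0 sigma) !cj_zact !(addSn, add0n).
have [-> -> -> ->] := cj_modE x.
by rewrite /conv5 /int5 /= !intrD !intrM; ring.
Qed.

(** [w] and [v] undo each other on [x] and [y]. Expansions are carried over by multiplication in
    [Z[C5]], and linear relations by its commutativity. *)
Lemma normal_integral_generator_transfer w v x y :
  y = zact w x -> x = zact v y ->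
  normal_integral_generator sigma x -> normal_integral_generator sigma y.
Proof.
move=> yE xE [hO hspan hfree].
have yO : ring_of_integers y.
  rewrite yE; apply/(integral_embedding iota); rewrite /zact rmorph_sum /=.
  apply: rpred_sum => i _; rewrite raddfMz /= rpredMz //.
  by apply/(integral_embedding iota); apply: hO.
split=> [i|u /hspan[k uE]|k hk i].
- exact: gal_integral.
- exists (conv5 k v); rewrite uE -/(zact _ x) xE; exact: zact_conv.
by apply: hfree => //; rewrite -/(zact k x) xE zactC /zact hk -/(zact v 0) zact0.
Qed.

Lemma normal_integral_generator_opp x : normal_integral_generator sigma x ->
  normal_integral_generator sigma (- x).
Proof.
have e y : - y = zact (int5 (-1) 0 0 0 0) y.
  apply: (fmorph_inj iota); rewrite -!(cj0 sigma) cj_zact /int5 /= /cj.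
  by rewrite !rmorphN; ring.
apply: (normal_integral_generator_transfer (e x)).
by rewrite -[LHS]opprK; apply: e.
Qed.

Lemma normal_integral_generator_gal (l : nat) x : normal_integral_generator sigma x ->
  normal_integral_generator sigma ((sigma ^+ l)%g x).
Proof.
elim: l x => [|l IH] x hx; first by rewrite expg0 gal_id.
rewrite -addn1 galX_add; apply: IH.
have e y : (sigma ^+ 1)%g y = zact (int5 0 1 0 0 0) y.
  apply: (fmorph_inj iota); rewrite -!(cj0 sigma) cj_zact /int5 /= cj_gal.
  by rewrite !(addSn, add0n); ring.
have e' y : (sigma ^+ 4)%g y = zact (int5 0 0 0 0 1) y.
  apply: (fmorph_inj iota); rewrite -!(cj0 sigma) cj_zact /int5 /= cj_gal.
  by rewrite !(addSn, add0n); ring.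
apply: (normal_integral_generator_transfer (v := int5 0 0 0 0 1) (e x)) hx.
by rewrite -e' -galX_add hs5.
Qed.

Lemma normal_integral_generator_unit x : normal_integral_generator sigma x ->
  normal_integral_generator sigma (zact (int5 1 0 (-1) (-1) 0) x).
Proof.
apply: (normal_integral_generator_transfer (v := int5 1 (-1) 0 0 (-1)) erefl).
apply: (fmorph_inj iota); rewrite -!(cj0 sigma) !cj_zact !(addSn, add0n).
have [-> -> -> ->] := cj_modE x.
by rewrite /int5 /=; ring.
Qed.

Lemma normal_integral_generator_unitV x : normal_integral_generator sigma x ->
  normal_integral_generator sigma (zact (int5 1 (-1) 0 0 (-1)) x).
Proof.
apply: (normal_integral_generator_transfer (v := int5 1 0 (-1) (-1) 0) erefl).
apply: (fmorph_inj iota); rewrite -!(cj0 sigma) !cj_zact !(addSn, add0n).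
have [-> -> -> ->] := cj_modE x.
by rewrite /int5 /=; ring.
Qed.

(** * All generators obtained from one *)

Section Generators.

Variable X : int -> L.
Hypothesis hX0 : normal_integral_generator sigma (X 0).
Hypothesis hX : forall (k : int) (t : nat),
  cj t (X k) = ratr (a_seq k) * cj t (X 0)
    + ratr (b_seq k) * (cj (t + 1) (X 0) + cj (t + 4) (X 0))
    - ratr (c_seq k) * (cj (t + 2) (X 0) + cj (t + 3) (X 0)).

Lemma normal_integral_generator_seq k : normal_integral_generator sigma (X k).
Proof.
have up j : X (j + 1) = zact (int5 1 0 (-1) (-1) 0) (X j).
  apply: (fmorph_inj iota); rewrite -!(cj0 sigma) cj_zact.
  rewrite (hX (j + 1)) !(hX j) !(addSn, add0n).
  have [-> -> -> ->] := cj_modE (X 0); have [-> -> ->] := abc_seqS j.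
  move: (a_seq j) (b_seq j) (c_seq j) => A B C; pose rr := (ratr : rat -> algC).
  by rewrite /int5 /= !(rmorphD rr, rmorphM rr, rmorph1 rr) /=; ring.
have down j : X (j - 1) = zact (int5 1 (-1) 0 0 (-1)) (X j).
  apply: (fmorph_inj iota); rewrite -!(cj0 sigma) cj_zact.
  rewrite (hX (j - 1)) !(hX j) !(addSn, add0n).
  have [-> -> -> ->] := cj_modE (X 0); have [-> -> ->] := abc_seqP j.
  move: (a_seq j) (b_seq j) (c_seq j) => A B C; pose rr := (ratr : rat -> algC).
  by rewrite /int5 /= !(rmorphB rr, rmorphD rr, rmorphM rr, rmorph1 rr) /=; ring.
elim/int_rec: k => [//|k IH|k IH].
  by rewrite -addn1 PoszD up; apply: normal_integral_generator_unit.
by rewrite -addn1 PoszD opprD down; apply: normal_integral_generator_unitV.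
Qed.

Lemma sym_combination (l : 'I_5) (z0 z1 z2 : int) (k : int) (s : bool) x :
  [/\ z0%:~R = (-1) ^+ s * a_seq k, z1%:~R = (-1) ^+ s * b_seq k
    & z2%:~R = - ((-1) ^+ s * c_seq k)] ->
  iota x = z0%:~R * cj l (X 0) + z1%:~R * (cj (l + 1) (X 0) + cj (l + 4) (X 0))
    + z2%:~R * (cj (l + 2) (X 0) + cj (l + 3) (X 0)) ->
  exists (l : 'I_5) (k : int),
    x = (sigma ^+ l)%g (X k) \/ x = - (sigma ^+ l)%g (X k).
Proof.
move=> [h0 h1 h2] xE.
have cast (q : int) (r : rat) : q%:~R = r -> q%:~R = ratr r :> algC.
  by move=> <-; rewrite ratr_int.
rewrite (cast _ _ h0) (cast _ _ h1) (cast _ _ h2) in xE.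
have e : iota x = (-1) ^+ s * cj l (X k).
  rewrite xE (hX k); move: (a_seq k) (b_seq k) (c_seq k) => A B C.
  pose rr := (ratr : rat -> algC).
  have rs : ratr ((-1) ^+ s) = (-1) ^+ s :> algC by rewrite rmorph_sign.
  move: ((-1) ^+ s) rs => t rs; rewrite !(rmorphN rr, rmorphM rr) /= rs.
  by ring.
exists l, k; move: e; case: s {h0 h1 h2 xE} => /= e; [right | left];
  apply: (fmorph_inj iota); rewrite e ?rmorphN /= -/(cj l (X k)); ring.
Qed.

Lemma normal_integral_generator_classify x : normal_integral_generator sigma x ->
  exists (l : 'I_5) (k : int),
    x = (sigma ^+ l)%g (X k) \/ x = - (sigma ^+ l)%g (X k).
Proof.
move=> [xO xspan _]; have [X0O X0span X0free] := hX0.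
have s0 y : (sigma ^+ (ord0 : 'I_5))%g y = y by rewrite expg0 gal_id.
have [w xE] : exists w, x = zact w (X 0).
  by have [|w hw] := X0span x; [have := xO ord0; rewrite s0 | exists w].
have [v XE] : exists v, X 0 = zact v x.
  by have [|v hv] := xspan (X 0); [have := X0O ord0; rewrite s0 | exists v].
pose y0 := w ord0; pose y1 := w (lift ord0 ord0).
pose y2 := w (lift ord0 (lift ord0 ord0)).
pose y3 := w (lift ord0 (lift ord0 (lift ord0 ord0))).
pose y4 := w (lift ord0 (lift ord0 (lift ord0 (lift ord0 ord0)))).
pose v0 := v ord0; pose v1 := v (lift ord0 ord0).
pose v2 := v (lift ord0 (lift ord0 ord0)).
pose v3 := v (lift ord0 (lift ord0 (lift ord0 ord0))).
pose v4 := v (lift ord0 (lift ord0 (lift ord0 (lift ord0 ord0)))).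
have iE : iota x = y0%:~R * cj 0 (X 0) + y1%:~R * cj 1 (X 0)
    + y2%:~R * cj 2 (X 0) + y3%:~R * cj 3 (X 0) + y4%:~R * cj 4 (X 0).
  by rewrite -(cj0 sigma) {1}xE cj_zact.
(* [E] is [w v - 1] in [Z[C5]]. It annihilates [X 0], whose conjugates are independent, so [w] is a
   unit with inverse [v]. *)
pose E (i : 'I_5) := conv5 w v i - (i == ord0)%:Z.
have E0 i : E i = 0.
  apply: X0free; rewrite -/(zact E (X 0)); apply/eqP.
  rewrite -(fmorph_eq0 iota) -(cj0 sigma) cj_zact /E /= !subr0 intrB.
  have e0 : iota (X 0) = iota (zact (conv5 w v) (X 0)).
    by rewrite {1}XE {1}xE zactC zact_conv.
  rewrite -!(cj0 sigma) cj_zact in e0; rewrite mulrBl mul1r {2}e0.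
  by apply/eqP; ring.
have h0 := E0 ord0; have h1 := E0 (lift ord0 ord0).
have h2 := E0 (lift ord0 (lift ord0 ord0)).
have h3 := E0 (lift ord0 (lift ord0 (lift ord0 ord0))).
have h4 := E0 (lift ord0 (lift ord0 (lift ord0 (lift ord0 ord0)))).
rewrite /E /conv5 /int5 /= ?subr0 in h0 h1 h2 h3 h4.
rewrite -/y0 -/y1 -/y2 -/y3 -/y4 -/v0 -/v1 -/v2 -/v3 -/v4 in h0 h1 h2 h3 h4.
move/subr0_eq: h0 => h0.
clearbody y0 y1 y2 y3 y4 v0 v1 v2 v3 v4; clear E E0 XE xE.
have [m5 m6 m7 m8] := cj_modE (X 0).
(* If [Y = g^(2l) Y*], the coefficients are symmetric about the index [l]; [sym_unit] is applied to
   [g^-l Y] and its inverse [g^l V]. *)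
case: (unit_symmetric h0 h1 h2 h3 h4) => [[e1 e2]|[e1 e2]|[e1 e2]|[[e1 e2]|[e1 e2]]];
  rewrite ?e1 ?e2 in h0 h1 h2 h3 h4 iE.
- have [k [s hk]] : exists (k : int) (s : bool),
      [/\ y0%:~R = (-1) ^+ s * a_seq k, y4%:~R = (-1) ^+ s * b_seq k
        & y3%:~R = - ((-1) ^+ s * c_seq k)].
    by apply: (@sym_unit y0 y4 y3 v0 v1 v2 v3 v4); lia.
  apply: (sym_combination (l := ord0) hk); rewrite iE /= !(addSn, add0n); ring.
- have [k [s hk]] : exists (k : int) (s : bool),
      [/\ y1%:~R = (-1) ^+ s * a_seq k, y0%:~R = (-1) ^+ s * b_seq k
        & y4%:~R = - ((-1) ^+ s * c_seq k)].
    by apply: (@sym_unit y1 y0 y4 v4 v0 v1 v2 v3); lia.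
  apply: (sym_combination (l := lift ord0 ord0) hk).
  by rewrite iE /= /bump /= !(addSn, add0n) m5; ring.
- have [k [s hk]] : exists (k : int) (s : bool),
      [/\ y2%:~R = (-1) ^+ s * a_seq k, y1%:~R = (-1) ^+ s * b_seq k
        & y0%:~R = - ((-1) ^+ s * c_seq k)].
    by apply: (@sym_unit y2 y1 y0 v3 v4 v0 v1 v2); lia.
  apply: (sym_combination (l := lift ord0 (lift ord0 ord0)) hk).
  by rewrite iE /= /bump /= !(addSn, add0n) m5 m6; ring.
- have [k [s hk]] : exists (k : int) (s : bool),
      [/\ y3%:~R = (-1) ^+ s * a_seq k, y2%:~R = (-1) ^+ s * b_seq k
        & y1%:~R = - ((-1) ^+ s * c_seq k)].
    by apply: (@sym_unit y3 y2 y1 v2 v3 v4 v0 v1); lia.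
  apply: (sym_combination (l := lift ord0 (lift ord0 (lift ord0 ord0))) hk).
  by rewrite iE /= /bump /= !(addSn, add0n) m5 m6 m7; ring.
have [k [s hk]] : exists (k : int) (s : bool),
    [/\ y4%:~R = (-1) ^+ s * a_seq k, y3%:~R = (-1) ^+ s * b_seq k
      & y2%:~R = - ((-1) ^+ s * c_seq k)].
  by apply: (@sym_unit y4 y3 y2 v1 v2 v3 v4 v0); lia.
apply: (sym_combination (l := lift ord0 (lift ord0 (lift ord0 (lift ord0 ord0)))) hk).
by rewrite iE /= /bump /= !(addSn, add0n) m5 m6 m7 m8; ring.
Qed.

End Generators.

End GroupRingAction.

Theorem theorem4p4 (n : int) (hn : ~~ (5 %| n)%Z)
  (L : splittingFieldType rat) (rho : L)
  (hroot : root (map_poly intr (lehmer_poly n)) rho)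
  (hL : <<1; rho>>%VS = fullv)
  (sigma : gal_of {:L})
  (hgen : generator 'Gal({:L} / 1) sigma)
  (hsigma : sigma rho =
     (n%:~R + 2 + n%:~R * rho - rho ^+ 2) / (1 + (n%:~R + 2) * rho))
  (a b c d e : nat)
  (hpos : [/\ (0 < a)%N, (0 < b)%N, (0 < c)%N, (0 < d)%N & (0 < e)%N])
  (hDelta : Delta n = (a * b ^ 2 * c ^ 3 * d ^ 4 * e ^ 5)%N%:Z)
  (hsqf : [/\ squarefree a, squarefree b, squarefree c & squarefree d])
  (hcop : [&& coprime a b, coprime a c, coprime a d,
              coprime b c, coprime b d & coprime c d])
  (zeta : algC) (hzeta : 5.-primitive_root zeta)
  (alpha1 alpha2 alpha3 : algC)
  (halpha1 : normalized_factor zeta (b * c ^ 2 * d ^ 3 * e ^ 3)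
               (A_ zeta n) alpha1)
  (halpha2 : normalized_factor zeta (b * c * d ^ 2 * e ^ 2)
               (B_ zeta n) alpha2)
  (halpha3 : normalized_factor zeta (c * d * e) (C_ zeta n) alpha3)
  (beta0 beta1 beta2 beta3 : int)
  (hbeta : alpha1 * alpha2 * alpha3 =
     beta0%:~R + beta1%:~R * zeta + beta2%:~R * zeta ^+ 2
     + beta3%:~R * zeta ^+ 3) :
  forall x : L,
    normal_integral_generator sigma x <->
    exists (l : 'I_5) (k : int),
      x = (sigma ^+ l)%g (xi sigma rho n b c d e beta0 beta1 beta2 beta3 k) \/
      x = - (sigma ^+ l)%g (xi sigma rho n b c d e beta0 beta1 beta2 beta3 k).
Proof.
have [iota _] := num_field_embedding hL.
have hs5 := gal_order5 hroot hL hsigma.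
pose X := xi sigma rho n b c d e beta0 beta1 beta2 beta3.
have hX0 : normal_integral_generator sigma (X 0).
  by apply: xi0_normal_integral_generator; eassumption.
have hX k t := cj_xi beta0 beta1 beta2 beta3 hroot hL hsigma hpos iota k t.
move=> x; split=> [hx|[l [k hx]]].
  exact: (normal_integral_generator_classify hs5 (X := X) hX0 hX hx).
have hk := normal_integral_generator_seq hs5 (X := X) hX0 hX k.
have hg := normal_integral_generator_gal hs5 iota l hk.
by case: hx => ->; last apply: (normal_integral_generator_opp hs5 iota).
Qed.
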